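(* Assume $C>C_P$. Let $v_\theta^\varepsilon$ be an $\varepsilon$-suboptimal global minimizer of $\mathcal J_f^C$ over $\mathcal N_\theta$, and let $u$ be the solution of $-\Delta u=f$ in $\Omega$, $u=0$ on $\partial\Omega$. There exists a constant $K>0$ such that $$\inf_{c\in\mathbb R}\|v_\theta^\varepsilon-u-c\|_{H^1(\Omega)}\le K\inf_{w_\theta\in\mathcal N_\theta}\Big\{C\|\Delta(w_\theta-u)\|_0+|w_\theta-u|_1+\varepsilon+\big(C\|\Delta(w_\theta-u)\|_0+|w_\theta-u|_1+\varepsilon\big)^{1/2}\Big\}.$$
   Context: $\Omega\subset\mathbb R^d$ is a bounded connected Lipschitz domain. Write $\|v\|_0=\|v\|_{L^2(\Omega)}$ and $|v|_1=\|\nabla v\|_{L^2(\Omega)}$. Let $\mathcal V=\{v\in H^1(\Omega):\Delta v\in L^2(\Omega)\}$, where the Laplacian is understood in the distributional sense. It is assumed that the homogeneous Dirichlet problem $-\Delta u=f$ in $\Omega$, $u=0$ on $\partial\Omega$ admits a solution $u\in\mathcal V\cap H^1_0(\Omega)$ (so that $f=-\Delta u\in L^2(\Omega)$). For $C>0$ define $\mathcal J_f^C(v)=C\|\Delta v+f\|_0+|v|_1$ for $v\in\mathcal V$. The constant $C_P:=\sup_{0\ne w\in H^1_0(\Omega)}\|w\|_0/|w|_1$ is the sharp Dirichlet Poincaré constant of $\Omega$. $\mathcal N_\theta=\{v_\theta(\cdot;\vartheta):\vartheta\in\Theta\}\subset\mathcal V$ is a (nonempty) fully connected neural-network trial class,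 where $\vartheta$ denotes the trainable parameters, ranging over a parameter set $\Theta$. For $\varepsilon>0$, an $\varepsilon$-suboptimal global minimizer of $\mathcal J_f^C$ over $\mathcal N_\theta$ is an element $v_\theta^\varepsilon\in\mathcal N_\theta$ with $\mathcal J_f^C(v_\theta^\varepsilon)\le\inf_{v_\theta\in\mathcal N_\theta}\mathcal J_f^C(v_\theta)+\varepsilon$. *)

(* Defs.v *)
From HB Require Import structures.
From mathcomp Require Import all_boot all_order all_algebra.
From mathcomp Require Import all_classical all_reals all_analysis.

Set Implicit Arguments.
Unset Strict Implicit.
Unset Printing Implicit Defensive.
Import Order.TTheory GRing.Theory Num.Theory.
Import numFieldNormedType.Exports.

Local Open Scope classical_set_scope.
Local Open Scope ring_scope.

(* The sigma-algebra on R^d is generated by the coordinates, as the library   *)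
(* does for n.-tuple T; it is the Borel sigma-algebra.                        *)
Definition measure_rV_display : measure_display.
Proof. exact: default_measure_display. Qed.

Section measurable_rV.
Context (R : realType) (d : nat).

Let coord (i : 'I_d) (x : 'rV[R]_d) : R := x ord0 i.

Let rV_set0 : g_sigma_preimage coord set0.
Proof. exact: sigma_algebra0. Qed.

Let rV_setC A : g_sigma_preimage coord A -> g_sigma_preimage coord (~` A).
Proof. exact: sigma_algebraC. Qed.

Let rV_bigcup (F : (set 'rV[R]_d)^nat) :
  (forall i, g_sigma_preimage coord (F i)) ->
  g_sigma_preimage coord (\bigcup_i (F i)).
Proof. exact: sigma_algebra_bigcup. Qed.

HB.instance Definition _ := @isMeasurable.Build measure_rV_display
  'rV[R]_d (g_sigma_preimage coord) rV_set0 rV_setC rV_bigcup.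

End measurable_rV.

Section lebesgue_measure_rV.
Context {R : realType}.

Lemma measurable_coord_rV d (i : 'I_d) :
  measurable_fun [set: 'rV[R]_d] (fun x => x ord0 i).
Proof.
move=> _ Y mY; rewrite setTI; apply: sub_sigma_algebra => /=.
rewrite -bigcup_seq/=; exists i => /=; first by rewrite mem_index_enum.
by exists Y => //; rewrite setTI.
Qed.

Lemma measurable_fun_rV dT (T : measurableType dT) d (f : T -> 'rV[R]_d) :
  (forall i, measurable_fun [set: T] (fun t => f t ord0 i)) ->
  measurable_fun [set: T] f.
Proof.
move=> mf _.
change (measurable `<=` [set A | measurable ([set: T] `&` f @^-1` A)]).
apply: smallest_sub.
  split; first by rewrite /= preimage_set0 setI0.
    by move=> A /=; rewrite !setTI setTD preimage_setC; exact: measurableC.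
  move=> F /= mF; rewrite setTI preimage_bigcup; apply: bigcup_measurable => i _.
  by have := mF i; rewrite setTI.
move=> A; rewrite -bigcup_seq => -[i _ [B mB <-]] /=.
by rewrite setTI; have := mf i measurableT B mB; rewrite !setTI.
Qed.

Definition cons_rV d (xy : measurableTypeR R * 'rV[R]_d) : 'rV[R]_d.+1 :=
  row_mx (xy.1)%:M xy.2 : 'rV_(1 + d).

Definition uncons_rV d (x : 'rV[R]_d.+1) : measurableTypeR R * 'rV[R]_d :=
  (x ord0 ord0, \row_j x ord0 (lift ord0 j)).

Lemma cons_rVE d xy (i : 'I_d.+1) :
  cons_rV xy ord0 i = if unlift ord0 i is Some j then xy.2 ord0 j else xy.1.
Proof.
rewrite /cons_rV; case: unliftP => [j ->|->].
  have -> : lift ord0 j = rshift 1 j :> 'I_(1 + d) by apply/val_inj.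
  exact: row_mxEr.
have -> : ord0 = lshift d (ord0 : 'I_1) :> 'I_(1 + d) by apply/val_inj.
by apply: etrans (row_mxEl _ _ _ _) _; rewrite mxE eqxx mulr1n.
Qed.

Lemma cons_rVK d : cancel (@cons_rV d) (@uncons_rV d).
Proof.
move=> [x y]; congr pair; first by rewrite cons_rVE unlift_none.
by apply/rowP => j; rewrite mxE cons_rVE liftK.
Qed.

Lemma measurable_cons_rV d : measurable_fun setT (@cons_rV d).
Proof.
apply: measurable_fun_rV => i; under eq_fun do rewrite cons_rVE.
case: unlift => [j|]; last exact: measurable_fst.
exact: (measurableT_comp (measurable_coord_rV j)).
Qed.

Lemma measurable_uncons_rV d : measurable_fun setT (@uncons_rV d).
Proof.
apply: measurable_fun_pair; first exact: measurable_coord_rV.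
apply: measurable_fun_rV => i; under eq_fun do rewrite mxE.
exact: measurable_coord_rV.
Qed.

Section lebesgue_rV_step.
Context (d : nat) (m : {sigma_finite_measure set 'rV[R]_d -> \bar R}).

Definition lebesgue_rVS : set 'rV[R]_d.+1 -> \bar R :=
  pushforward (@lebesgue_measure R \x m)%E (@cons_rV d).

Let lebesgue_rVS0 : lebesgue_rVS set0 = 0%E.
Proof. by rewrite /lebesgue_rVS /pushforward preimage_set0 measure0. Qed.

Let lebesgue_rVS_ge0 A : (0 <= lebesgue_rVS A)%E.
Proof. by rewrite /lebesgue_rVS /pushforward measure_ge0. Qed.

Let lebesgue_rVS_sigma_additive : semi_sigma_additive lebesgue_rVS.
Proof.
move=> F mF tF mUF; rewrite /lebesgue_rVS /pushforward preimage_bigcup.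
apply: measure_semi_sigma_additive.
- by move=> n; rewrite -[X in measurable X]setTI; exact: measurable_cons_rV.
- apply/trivIsetP => /= i j _ _ ij; rewrite -preimage_setI.
  by move/trivIsetP : tF => /(_ _ _ _ _ ij) ->//; rewrite preimage_set0.
- by rewrite -preimage_bigcup -[X in measurable X]setTI;
    exact: measurable_cons_rV.
Qed.

HB.instance Definition _ := isMeasure.Build _ _ _ lebesgue_rVS
  lebesgue_rVS0 lebesgue_rVS_ge0 lebesgue_rVS_sigma_additive.

Let lebesgue_rVS_sigma_finite : sigma_finite setT lebesgue_rVS.
Proof.
have /sigma_finiteP[F [TF ndF Foo]] := sigma_finiteT (@lebesgue_measure R).
have /sigma_finiteP[G [TG ndG Goo]] := sigma_finiteT m.
have UFG : \bigcup_k (F k `*` G k) = setT.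
  apply/seteqP; split => // -[x y] _.
  have [n _ Fnx] : (\bigcup_i F i) x by rewrite -TF.
  have [k _ Gky] : (\bigcup_i G i) y by rewrite -TG.
  exists (maxn n k) => //; split.
    by move: x Fnx; exact/subsetPset/ndF/leq_maxl.
  by move: y Gky; exact/subsetPset/ndG/leq_maxr.
exists (fun i => @uncons_rV d @^-1` (F i `*` G i)).
  by rewrite -preimage_bigcup UFG preimage_setT.
move=> i; have [mFi Fi] := Foo i; have [mGi Gi] := Goo i; split.
  by rewrite -[X in measurable X]setTI; apply: measurable_uncons_rV => //;
    exact: measurableX.
rewrite /lebesgue_rVS /pushforward (_ : _ @^-1` _ = F i `*` G i).
  by rewrite product_measure1E// lte_mul_pinfty// ge0_fin_numE.
rewrite -comp_preimage (_ : _ \o _ = id) ?preimage_id//.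
by apply/funext => x /=; rewrite cons_rVK.
Qed.

HB.instance Definition _ := Measure_isSigmaFinite.Build _ _ _ lebesgue_rVS
  lebesgue_rVS_sigma_finite.

End lebesgue_rV_step.

Fixpoint lebesgue_rV d : {sigma_finite_measure set 'rV[R]_d -> \bar R} :=
  match d with
  | 0 => \d_(0 : 'rV[R]_0)
  | d'.+1 => lebesgue_rVS (lebesgue_rV d')
  end.

End lebesgue_measure_rV.

Section domains.
Context {R : realType} {d : nat}.
Implicit Types Omega : set 'rV[R]_d.

(* Near each boundary point, in the orthogonal coordinates [x *m Q], the set  *)
(* is the open epigraph of a Lipschitz function of the coordinates other than *)
(* the k-th one.                                                              *)
Definition lipschitz_boundary Omega :=
  forall x0, (closure Omega `\` Omega^°) x0 ->
  exists (Q : 'M[R]_d) (k : 'I_d) (gamma : 'rV[R]_d.-1 -> R),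
    [/\ Q *m Q^T = 1%:M, lipschitz gamma &
        \forall x \near x0,
          Omega x <-> gamma (col' k (x *m Q)) < (x *m Q) ord0 k].

Definition bounded_lipschitz_domain Omega :=
  [/\ Omega !=set0, open Omega, connected Omega, bounded_set Omega &
      lipschitz_boundary Omega].

End domains.

Section sobolev.
Context {R : realType} {d : nat}.
Implicit Types (Omega : set 'rV[R]_d) (f g u v w phi : 'rV[R]_d -> R).

Local Notation mu := (@lebesgue_rV R d).

Definition pderiv (i : 'I_d) phi : 'rV[R]_d -> R := 'D_(delta_mx ord0 i) phi.

Definition smooth phi :=
  forall (s : seq 'I_d) x, differentiable (foldr pderiv phi s) x.

(* C_c^oo(Omega) *)
Definition test_function Omega phi :=
  [/\ smooth phi, compact (closure [set x | phi x != 0]) &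
      closure [set x | phi x != 0] `<=` Omega].

(* Functions on Omega are represented by total functions on R^d, of which     *)
(* only the values on Omega matter ([g \_ Omega] is extension by zero), and   *)
(* not identified when they agree almost everywhere.                          *)
Definition L2 Omega g := g \_ Omega \in Lfun mu 2%:E.

Definition L2norm Omega g : R := fine ('N[mu]_2%:E[EFin \o g \_ Omega])%E.

Definition is_weak_pderiv Omega (i : 'I_d) v g :=
  forall phi, test_function Omega phi ->
  \int[mu]_(x in Omega) (v x * pderiv i phi x) =
  - \int[mu]_(x in Omega) (g x * phi x).

Definition is_weak_laplacian Omega v g :=
  forall phi, test_function Omega phi ->
  \int[mu]_(x in Omega) (v x * \sum_(i < d) pderiv i (pderiv i phi) x) =
  \int[mu]_(x in Omega) (g x * phi x).

(* A choice of representative (0 when there is none): on an open Omega the    *)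
(* weak derivatives are unique up to equality almost everywhere.              *)
Definition weak_pderiv Omega i v : 'rV[R]_d -> R :=
  xget (cst 0) [set g | L2 Omega g /\ is_weak_pderiv Omega i v g].

Definition weak_laplacian Omega v : 'rV[R]_d -> R :=
  xget (cst 0) [set g | L2 Omega g /\ is_weak_laplacian Omega v g].

Definition H1 Omega v :=
  L2 Omega v /\
  forall i, exists g, L2 Omega g /\ is_weak_pderiv Omega i v g.

Definition H1seminorm Omega v : R :=
  Num.sqrt (\sum_(i < d) L2norm Omega (weak_pderiv Omega i v) ^+ 2).

Definition H1norm Omega v : R :=
  Num.sqrt (L2norm Omega v ^+ 2 + H1seminorm Omega v ^+ 2).

(* the closure of C_c^oo(Omega) in H^1(Omega) *)
Definition H10 Omega v :=
  H1 Omega v /\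
  forall e : R, 0 < e ->
    exists2 phi, test_function Omega phi & H1norm Omega (v \- phi) < e.

Definition H1_laplacian Omega v :=
  H1 Omega v /\ exists g, L2 Omega g /\ is_weak_laplacian Omega v g.

(* Taken in the extended reals, so that [poincare Omega < C%:E] entails that  *)
(* the supremum is finite.                                                    *)
Definition poincare Omega : \bar R :=
  ereal_sup [set (L2norm Omega w / H1seminorm Omega w)%:E |
             w in [set w | H10 Omega w /\ ~ ae_eq mu Omega w (cst 0)]].

Definition dirichlet_solution Omega f u :=
  [/\ H1_laplacian Omega u, H10 Omega u & is_weak_laplacian Omega u (\- f)].

Definition residual Omega f (C : R) v : R :=
  C * L2norm Omega (weak_laplacian Omega v \+ f) + H1seminorm Omega v.

Definition suboptimal_minimizer Omega f (C : R) (N : set ('rV[R]_d -> R))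
    (eps : R) v :=
  N v /\
  residual Omega f C v <= inf [set residual Omega f C w | w in N] + eps.

End sobolev.

Section networks.
Context {R : realType}.

(* Weights and biases of a fully connected network with [n] inputs, hidden    *)
(* layers of widths [hidden] and one output.                                  *)
Fixpoint fcnn_param (n : nat) (hidden : seq nat) : Type :=
  match hidden with
  | [::] => ('M[R]_(n, 1) * 'rV[R]_1)%type
  | m :: hidden' => (('M[R]_(n, m) * 'rV[R]_m) * fcnn_param m hidden')%type
  end.

(* [sigma k] is the activation of the k-th hidden layer; the output layer is  *)
(* affine.                                                                    *)
Fixpoint fcnn (sigma : nat -> R -> R) (n : nat) (hidden : seq nat) :
    fcnn_param n hidden -> 'rV[R]_n -> R :=
  match hidden with
  | [::] => fun p x => (x *m p.1 + p.2) ord0 ord0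
  | m :: hidden' => fun p x =>
      fcnn (sigma \o succn) p.2 (map_mx (sigma 0%N) (x *m p.1.1 + p.1.2))
  end.

Definition fcnn_class (sigma : nat -> R -> R) (n : nat) (hidden : seq nat)
    (Theta : set (fcnn_param n hidden)) : set ('rV[R]_n -> R) :=
  [set fcnn sigma theta | theta in Theta].

End networks.

(* Main.v *)
Require Import Defs.
From HB Require Import structures.
From mathcomp Require Import finmap.
From mathcomp Require Import all_boot all_order all_algebra.
From mathcomp Require Import all_classical all_reals all_analysis.
From mathcomp Require Import measurable_realfun.
From mathcomp Require Import ring lra.

Set Implicit Arguments.
Unset Strict Implicit.
Unset Printing Implicit Defensive.
Import Order.TTheory GRing.Theory Num.Theory.
Import numFieldNormedType.Exports.

Local Open Scope classical_set_scope.
Local Open Scope ring_scope.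

(** Write [e = v - u], let [r] be the norm of the Laplacian of [e], and [|.|_1]
    the H^1 seminorm. As [u] vanishes on the boundary, Green's formula turns
    the product of the gradients of [u] and [e] into minus the product of [u]
    and the Laplacian of [e]. It is thus at most [D r |u|_1] for some [D < C],
    because the Poincare constant is less than [C] ([gradip_le_laplacian]).
    Quasi-minimality of [v] bounds [C r + |v|_1] by [|u|_1 + E w] for every
    competitor [w]. Expanding [|v|_1^2 = |u + e|_1^2] and using the strict
    inequality [D < C], one bounds first [r] by a multiple of [E w], and then
    [|e|_1^2] by a multiple of [E w + (E w)^2] ([energy_estimate]). The square
    root in the final estimate appears because the excess of [|v|_1] over
    [|u|_1] controls [|e|_1] only quadratically.

    The passage from the seminorm to the distance of [e] to the constants is
    the Poincare-Wirtinger inequality ([poincare_wirtinger]), which is proved by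
    means of translations alone. If the segments from the points of [A] to
    those of [A + h] stay in the domain, then the norm over [A] of
    [e(x + h) - e(x)] is at most [|h|] times the norm of the gradient
    ([L2norm_translation]). Averaging over all translations between two points
    of a ball of the sup norm gives the inequality on that ball
    ([poincare_ball_const]). A set that can be translated inside the domain
    into a set on which [e - c] is controlled inherits the control
    ([reach_translate]). Hence, by connectedness, the control spreads from one
    ball to a neighborhood of each interior point ([reach_interior]); near a
    boundary point the domain is an epigraph, and translating along the axis of
    the epigraph moves a neighborhood of the point into the interior
    ([reach_boundary]). Compactness of the closure leaves finitely many sets.

    The translation estimate and the uniqueness of weak derivatives and
    Laplacians both follow by duality with test functions ([L2norm_le_dual]),
    hence from the density of the latter in L^2 ([test_function_dense]). *)

(** * Lebesgue measure on row vectors *)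

Section measure_rV.
Context {R : realType}.

Lemma measurable_addr_rV d (h : 'rV[R]_d) :
  measurable_fun [set: 'rV[R]_d] (fun x => x + h).
Proof.
apply: measurable_fun_rV => i; under eq_fun do rewrite mxE.
apply: measurable_funD; last exact: measurable_cst.
exact: measurable_coord_rV.
Qed.

Lemma lebesgue_measure_shift (a : R) (A : set (measurableTypeR R)) :
  measurable A ->
  lebesgue_measure ((fun x : measurableTypeR R => x + a) @^-1` A) =
  lebesgue_measure A.
Proof.
move=> mA; apply/esym.
have mf : measurable_fun setT (fun x : measurableTypeR R => x + a : measurableTypeR R).
  exact: measurable_funD.
rewrite -[RHS]/(pushforward lebesgue_measure (fun x : measurableTypeR R => x + a : measurableTypeR R) A).
apply: lebesgue_measure_unique => //= _ [[b c]] _ <-.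
rewrite /pushforward.
have -> : (fun x : R => x + a) @^-1` `]b, c]%classic = `]b - a, c - a]%classic.
  by apply/seteqP; split => x /=; rewrite !in_itv/= ltrBlDr lerBrDr.
by rewrite !lebesgue_measure_itv/= !lte_fin ltrD2r -!EFinB opprB addrA subrK.
Qed.

(** Both sides are product measures of the same one-dimensional factors, so
    induction on the dimension reduces the claim to the line. *)
Lemma lebesgue_rV_shift d (h : 'rV[R]_d) (A : set 'rV[R]_d) :
  measurable A ->
  lebesgue_rV d ((fun x => x + h) @^-1` A) = lebesgue_rV d A.
Proof.
elim: d h A => [|d IH] h A mA.
  by congr (lebesgue_rV 0 _); apply/seteqP; split => x /=; rewrite !thinmx0.
rewrite /= /lebesgue_rVS /pushforward.
pose a := h ord0 ord0; pose k := \row_j h ord0 (lift ord0 j).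
pose T (z : measurableTypeR R * 'rV[R]_d) : measurableTypeR R * 'rV[R]_d :=
  (z.1 + a, z.2 + k).
have mT : measurable_fun setT T.
  apply: measurable_fun_pair => /=; first exact: measurable_funD.
  exact: (measurableT_comp (measurable_addr_rV k)).
set B := cons_rV (d:=d) @^-1` A.
have mB : measurable B.
  by rewrite -[B]setTI; apply: measurable_cons_rV.
have -> : cons_rV (d:=d) @^-1` ((fun x => x + h) @^-1` A) = T @^-1` B.
  suff E z : cons_rV z + h = cons_rV (T z).
    by apply/seteqP; split => z /=; rewrite /B/= E.
  apply/rowP => i; rewrite mxE !cons_rVE /T /=.
  by case: unliftP => [j ->|->] //=; rewrite !mxE.
apply/esym; rewrite -[RHS]/(pushforward _ T B).
apply: product_measure_unique => // C D mC mD.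
pose C' := (fun x : measurableTypeR R => x + a : measurableTypeR R) @^-1` C.
pose D' := (fun x : 'rV[R]_d => x + k) @^-1` D.
have mC' : measurable C'.
  rewrite -[C']setTI.
  suff : measurable_fun setT (fun x : measurableTypeR R => x + a : measurableTypeR R) by apply.
  exact: measurable_funD.
have mD' : measurable D' by rewrite -[D']setTI; exact: measurable_addr_rV.
transitivity ((@lebesgue_measure R \x lebesgue_rV d)%E (C' `*` D')); first by [].
by rewrite product_measure1E//; congr (_ * _)%E; [exact: lebesgue_measure_shift|exact: IH].
Qed.

Lemma in_ball_rV d (x y : 'rV[R]_d) (r : R) : 0 < r ->
  ball x r y <-> forall i, `|x ord0 i - y ord0 i| < r.
Proof.
move=> r0; split => [[_ xy] i|xy]; first exact: xy.
by split => // i j; rewrite ord1; exact: xy.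
Qed.

Lemma ler_coord_norm d (h : 'rV[R]_d) i : `|h ord0 i| <= `|h|.
Proof.
apply/ler_addgt0Pr => e e0.
have : ball (0 : 'rV[R]_d) (`|h| + e) h by rewrite -ball_normE /= sub0r normrN ltrDl.
rewrite in_ball_rV; last exact: ltr_wpDl.
by move=> /(_ i); rewrite mxE sub0r normrN => /ltW.
Qed.

Lemma norm_rV_le n (y : 'rV[R]_n) (c : R) : 0 <= c ->
  (forall j, `|y ord0 j| <= c) -> `|y| <= c.
Proof.
move=> c0 yc; apply/ler_addgt0Pr => s s0; apply/ltW.
suff : ball (0 : 'rV[R]_n) (c + s) y by rewrite -ball_normE /= sub0r normrN.
apply/in_ball_rV; first exact: ltr_wpDl.
by move=> j; rewrite mxE sub0r normrN; apply: le_lt_trans (yc j) _; rewrite ltrDl.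
Qed.

Lemma measurable_ball_rV d (x : 'rV[R]_d) (r : R) : 0 < r -> measurable (ball x r).
Proof.
move=> r0.
have -> : ball x r = \bigcap_(i in [set: 'I_d])
    ((fun y : 'rV[R]_d => y ord0 i) @^-1` ball (x ord0 i) r).
  by apply/seteqP; split => y /=; rewrite in_ball_rV// => h i; [move=> _|]; apply: h.
apply: fin_bigcap_measurable => // i _.
by rewrite -[X in measurable X]setTI; apply: measurable_coord_rV => //; exact: measurable_ball.
Qed.

Lemma lebesgue_rV_ball d (x : 'rV[R]_d) (r : R) : 0 < r ->
  lebesgue_rV d (ball x r) = ((r *+ 2) ^+ d)%:E.
Proof.
move=> r0; elim: d x => [|d IH] x.
  by rewrite /= diracE mem_set// ?expr0// in_ball_rV// => -[].
rewrite /= /lebesgue_rVS /pushforward.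
have -> : cons_rV (d:=d) @^-1` ball x r =
   (ball (x ord0 ord0) r : set (measurableTypeR R)) `*` ball (\row_j x ord0 (lift ord0 j)) r.
  apply/seteqP; split => -[a y] /=; rewrite !in_ball_rV//.
    move=> h; split => [|i].
      by have := h ord0; rewrite cons_rVE unlift_none.
    by have := h (lift ord0 i); rewrite cons_rVE liftK mxE.
  move=> [h1 h2] i; rewrite cons_rVE.
  by case: unliftP => [j ->|->] //=; have := h2 j; rewrite mxE.
rewrite product_measure1E//; [|exact: measurable_ball|exact: measurable_ball_rV].
by rewrite IH exprS EFinM; congr (_ * _)%E; exact/lebesgue_measure_ball/ltW.
Qed.

(** Balls with rational data form a countable base of the topology. It makes
    open sets measurable, and later exhausts them by countably many bumps. *)
Lemma open_rat_ball d (U : set 'rV[R]_d) x : open U -> U x ->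
  exists (c : 'rV[rat]_d) (k : nat), ball (map_mx ratr c : 'rV[R]_d) k.+1%:R^-1 x /\
    closure (ball (map_mx ratr c : 'rV[R]_d) k.+1%:R^-1) `<=` U.
Proof.
move=> oU Ux.
have /nbhs_ballP[e /= e0 eU] : nbhs x U by exact: open_nbhs_nbhs.
have e30 : 0 < e / 3 by rewrite divr_gt0.
have [k _ /(_ k (leqnn k)) /= ke] := near_infty_natSinv_lt (PosNum e30).
set r := k.+1%:R^-1 in ke *.
have r0 : 0 < r by rewrite invr_gt0.
have /choice[c cE] : forall i : 'I_d, exists q : rat, `|ratr q - x ord0 i| < r.
  move=> i; have [q] := @rat_in_itvoo R (x ord0 i - r) (x ord0 i + r) (ltac:(lra)).
  by rewrite in_itv/= -ltr_distl => ?; exists q.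
exists (\row_i c i), k; have xr : ball (map_mx ratr (\row_i c i) : 'rV[R]_d) r x.
  by rewrite in_ball_rV// => i; rewrite !mxE.
split => // y yc; apply: eU.
have [z [rz yz]] := yc _ (nbhsx_ballx y r r0).
apply: (@le_ball _ _ _ (r + (r + r))); first by lra.
apply: (ball_triangle (ball_sym xr)).
by apply: (ball_triangle rz); exact: ball_sym.
Qed.

Lemma open_measurable_rV d (U : set 'rV[R]_d) : open U -> measurable U.
Proof.
move=> oU.
pose B (p : 'rV[rat]_d * nat) : set 'rV[R]_d := ball (map_mx ratr p.1 : 'rV[R]_d) p.2.+1%:R^-1.
have -> : U = \bigcup_(p in [set p | B p `<=` U]) B p.
  apply/seteqP; split => [x Ux|x [p pU Bpx]]; last exact: pU.
  have [c [k [cx cU]]] := open_rat_ball oU Ux.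
  by exists (c, k) => //=; apply: subset_trans cU; exact: subset_closure.
rewrite bigcup_mkcond; apply: countable_bigcupT_measurable => [|p].
  exact: countableP.
by case: ifP => // _; apply: measurable_ball_rV; rewrite invr_gt0.
Qed.

(** The open sets are the pi-system of the Dynkin argument for the density of
    test functions. *)
Lemma measurable_rV_open d :
  @measurable _ 'rV[R]_d = <<s [set U : set 'rV[R]_d | open U] >>.
Proof.
apply/seteqP; split => [|]; last first.
  by apply: smallest_sub => [|U]; [exact: sigma_algebra_measurable|exact: open_measurable_rV].
apply: smallest_sub => [|A]; first exact: smallest_sigma_algebra.
rewrite -bigcup_seq => -[i _ [B mB <-]].
pose T := g_sigma_algebraType [set U : set 'rV[R]_d | open U].
suff mi : measurable_fun [set: T] (fun x : T => (x : 'rV[R]_d) ord0 i).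
  exact: mi.
apply: (measurability _ (RGenOInfty.measurableE R)) => _ [_ [a ->] <-].
rewrite setTI; apply: sub_sigma_algebra => /=.
apply: open_comp => [x _|]; last exact: rray_open.
exact: coord_continuous.
Qed.

Lemma continuous_measurable_rV d (f : 'rV[R]_d -> R) :
  continuous f -> measurable_fun setT f.
Proof.
move=> cf; apply: (measurability _ (RGenOInfty.measurableE R)) => _ [_ [a ->] <-].
rewrite setTI; apply: open_measurable_rV.
by apply: open_comp => [x _|]; [exact: cf|exact: rray_open].
Qed.

Local Open Scope ereal_scope.

Lemma integral_shift d (h : 'rV[R]_d) (f : 'rV[R]_d -> \bar R) :
  measurable_fun setT f ->
  \int[lebesgue_rV d]_x f (x + h)%R = \int[lebesgue_rV d]_x f x.
Proof.
have ge0 (g : 'rV[R]_d -> \bar R) : measurable_fun setT g -> (forall x, 0 <= g x) ->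
    \int[lebesgue_rV d]_x g (x + h)%R = \int[lebesgue_rV d]_x g x.
  move=> mg g0.
  have := ge0_integral_pushforward (measurable_addr_rV h) (lebesgue_rV d)
    measurableT mg (fun x _ => g0 x).
  rewrite preimage_setT => <-.
  have mh := measurable_addr_rV h.
  apply: eq_measure_integral => A mA _.
  exact: lebesgue_rV_shift.
move=> mf; rewrite integralE [RHS]integralE; congr (_ - _).
- have mp : measurable_fun setT f^\+ by exact: measurable_funepos.
  rewrite -(ge0 _ mp (funepos_ge0 f)); apply: eq_integral => x _.
  by have /(congr1 (@^~ x)) := funepos_comp f (fun x => x + h)%R.
- have mp : measurable_fun setT f^\- by exact: measurable_funeneg.
  rewrite -(ge0 _ mp (funeneg_ge0 f)); apply: eq_integral => x _.
  by have /(congr1 (@^~ x)) := funeneg_comp f (fun x => x + h)%R.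
Qed.

Lemma integrable_shift d (h : 'rV[R]_d) (f : 'rV[R]_d -> \bar R) :
  (lebesgue_rV d).-integrable setT f ->
  (lebesgue_rV d).-integrable setT (fun x => f (x + h)%R).
Proof.
move=> /integrableP[mf fi]; apply/integrableP; split.
  exact: (measurableT_comp mf (measurable_addr_rV h)).
by rewrite (@integral_shift _ h (fun x => `|f x|))//; exact: measurableT_comp.
Qed.

End measure_rV.

(** * Smooth functions and test functions *)

Section smooth_functions.
Context {R : realType} {d : nat}.
Implicit Types (phi psi : 'rV[R]_d -> R) (x h : 'rV[R]_d).

(** Smoothness peels off the outermost derivative of a list; peeling the
    innermost one instead allows the induction that the product rule needs. *)
Fixpoint diffn (n : nat) phi : Prop :=
  match n with
  | 0 => forall x, differentiable phi x
  | n'.+1 => (forall x, differentiable phi x) /\ forall i, diffn n' (pderiv i phi)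
  end.

Lemma diffn_differentiable n phi : diffn n phi -> forall x, differentiable phi x.
Proof. by case: n => // n []. Qed.

Lemma smooth_pderiv i phi : smooth phi -> smooth (pderiv i phi).
Proof. by move=> sphi s x; rewrite -foldr_rcons; exact: sphi. Qed.

Lemma smoothP phi : smooth phi <-> forall n, diffn n phi.
Proof.
split=> [sphi n|dphi s].
  elim: n phi sphi => [|n IH] phi sphi; first by move=> x; exact: (sphi [::]).
  by split => [x|i]; [exact: (sphi [::])|apply: IH; exact: smooth_pderiv].
elim/last_ind: s phi dphi => [|s i IH] phi dphi x; first exact: (dphi 0%N).
by rewrite foldr_rcons; apply: IH => n; have [_] := dphi n.+1; exact.
Qed.

Lemma diffnW n phi : diffn n.+1 phi -> diffn n phi.
Proof.
elim: n phi => [|n IH] phi; first by case.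
by move=> [d0 d1]; split => // i; apply: IH; exact: d1.
Qed.

Lemma pderiv_cst i (c : R) : pderiv i (cst c : 'rV[R]_d -> R) = cst (0 : R).
Proof. by apply/funext => x; rewrite /pderiv derive_cst. Qed.

Lemma diffn_cst n (c : R) : diffn n (cst c : 'rV[R]_d -> R).
Proof.
elim: n c => [|n IH] c => [x|]; first exact: differentiable_cst.
by split=> [x|i]; [exact: differentiable_cst|rewrite pderiv_cst].
Qed.

Lemma pderivD i phi psi : (forall x, differentiable phi x) ->
  (forall x, differentiable psi x) ->
  pderiv i (fun x => phi x + psi x) = (fun x => pderiv i phi x + pderiv i psi x).
Proof.
move=> dphi dpsi; apply/funext => x.
by rewrite /pderiv deriveD//; exact: diff_derivable.
Qed.

Lemma pderivM i phi psi : (forall x, differentiable phi x) ->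
  (forall x, differentiable psi x) ->
  pderiv i (fun x => phi x * psi x) =
  (fun x => phi x * pderiv i psi x + psi x * pderiv i phi x).
Proof.
move=> dphi dpsi; apply/funext => x.
by rewrite /pderiv deriveM//; exact: diff_derivable.
Qed.

Lemma diffnD n phi psi : diffn n phi -> diffn n psi ->
  diffn n (fun x => phi x + psi x).
Proof.
elim: n phi psi => [|n IH] phi psi.
  by move=> d1 d2 x; exact: differentiableD.
move=> [d1 e1] [d2 e2]; split => [x|i]; first exact: differentiableD.
by rewrite pderivD//; apply: IH; [exact: e1|exact: e2].
Qed.

Lemma diffnM n phi psi : diffn n phi -> diffn n psi ->
  diffn n (fun x => phi x * psi x).
Proof.
elim: n phi psi => [|n IH] phi psi.
  by move=> d1 d2 x; exact: differentiableM.
move=> d1 d2; split => [x|i].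
  by apply: differentiableM; apply: (@diffn_differentiable n.+1).
rewrite pderivM; try exact: (@diffn_differentiable n.+1).
by apply: diffnD; apply: IH; try exact: diffnW; [exact: d2.2|exact: d1.2].
Qed.

Lemma smooth_cst (c : R) : smooth (fun _ : 'rV[R]_d => c).
Proof. by apply/smoothP => n; exact: diffn_cst. Qed.

Lemma smoothD phi psi : smooth phi -> smooth psi ->
  smooth (fun x => phi x + psi x).
Proof. by move=> /smoothP s1 /smoothP s2; apply/smoothP => n; exact: diffnD. Qed.

Lemma smoothM phi psi : smooth phi -> smooth psi ->
  smooth (fun x => phi x * psi x).
Proof. by move=> /smoothP s1 /smoothP s2; apply/smoothP => n; exact: diffnM. Qed.

Lemma smooth_prod (I : Type) (r : seq I) (F : I -> 'rV[R]_d -> R) :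
  (forall i, smooth (F i)) -> smooth (fun x => \prod_(i <- r) F i x).
Proof.
move=> sF; elim: r => [|i r IH].
  under eq_fun do rewrite big_nil.
  exact: smooth_cst.
under eq_fun do rewrite big_cons.
exact: smoothM.
Qed.

Lemma smooth_exp n phi : smooth phi -> smooth (fun x => phi x ^+ n).
Proof.
move=> sphi; elim: n => [|n IH]; first exact: smooth_cst.
under eq_fun do rewrite exprS.
exact: smoothM.
Qed.

End smooth_functions.

Section bump.
Context {R : realType}.

(** Every derivative of [exp (- 1 / x)], extended by zero to [x <= 0], is a
    linear combination of these functions. *)
Definition flat (n : nat) (x : R) : R :=
  if 0 < x then x^-1 ^+ n * expR (- x^-1) else 0.

Lemma flat_ge0 n x : 0 <= flat n x.
Proof.
by rewrite /flat; case: ifPn => // x0; rewrite mulr_ge0 ?expR_ge0// exprn_ge0// invr_ge0 ltW.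
Qed.

Lemma flat0_gt0 x : 0 < x -> 0 < flat 0 x.
Proof. by move=> x0; rewrite /flat x0 mulr_gt0// expR_gt0. Qed.

Lemma flat0_le1 x : flat 0 x <= 1.
Proof.
rewrite /flat; case: ifPn => // x0.
by rewrite expr0 mul1r expR_le1 oppr_le0 invr_ge0 ltW.
Qed.

Lemma flat_le n x : flat n x <= n.+1`!%:R * `|x|.
Proof.
rewrite /flat; case: ifPn => [x0|_]; last by rewrite mulr_ge0.
have y0 : 0 < x^-1 by rewrite invr_gt0.
have f0 : 0 < (n.+1`!%:R : R) by rewrite ltr0n fact_gt0.
rewrite gtr0_norm// expRN ler_pdivrMr ?expR_gt0// -(ler_pM2r y0) -exprSr.
rewrite mulrAC (mulrAC _ x) mulfVK ?gt_eqF// -ler_pdivrMl// mulrC.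
by apply: le_trans (expR_ge1Dxn n (ltW y0)); rewrite lerDr.
Qed.

(** At the origin the difference quotient of [flat n] is [flat n.+1], which
    tends to zero because exponentials dominate powers. *)
Lemma is_derive_flat (n : nat) (x : R) :
  is_derive x (1 : R) (flat n : R -> R) (- n%:R * flat n.+1 x + flat n.+2 x).
Proof.
have [x0|x0|<-] := ltgtP 0 x.
- have xN0 : x != 0 by rewrite gt_eqF.
  apply: (@near_eq_is_derive _ _ _ (fun x : R => x^-1 ^+ n * expR (- x^-1))).
    near=> z; rewrite /flat ifT//; near: z; exact: lt_nbhsr.
  rewrite /flat x0.
  have i1 : is_derive x (1 : R) (fun x : R => x^-1) (- x ^- 2 *: 1).
    exact: (@is_deriveV R id x 1 1).
  have i2 : is_derive x (1 : R) (fun x : R => x^-1 ^+ n)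
      ((n%:R * x^-1 ^+ n.-1) *: (- x ^- 2 *: 1)).
    have -> : (fun x : R => x^-1 ^+ n) = (fun x : R => x^-1) ^+ n.
      by apply/funext => z; rewrite fctE.
    exact: is_deriveX.
  have i3 : is_derive x (1 : R) (fun x : R => expR (- x^-1)) (expR (- x^-1) * - (- x ^- 2 *: 1)).
    exact: is_derive1_comp.
  have i4 := is_deriveM i2 i3.
  apply: is_derive_eq i4 _.
  rewrite /= /GRing.scale/= -exprVn.
  move: (x^-1) (expR _) => y e; case: (n) => [|m] /=; rewrite -?[m.+1.-1]/m !exprS; ring.
- have -> : - n%:R * flat n.+1 x + flat n.+2 x = 0.
    by rewrite /flat !ltNge (ltW x0)/= mulr0 addr0.
  apply: (@near_eq_is_derive _ _ _ (cst (0:R) : R -> R)).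
  near=> z; rewrite /flat ifF//; apply/negbTE; rewrite -leNgt ltW//; near: z; exact: lt_nbhsl.
- have E0 m : flat m 0 = 0 by rewrite /flat ltxx.
  rewrite !E0 mulr0 addr0.
  have cv : (fun h => h^-1 *: ((flat n \o shift 0) (h *: 1) - flat n 0)) @ 0^' --> (0 : R).
    apply/cvgrPdist_le => e e0; near=> h.
    rewrite sub0r normrN /= addr0 E0 subr0.
    have -> : h^-1 *: flat n h%:A = flat n.+1 h.
      rewrite /GRing.scale/= mulr1 /flat; case: ifPn => [_|]; last by rewrite mulr0.
      by rewrite mulrA -exprS.
    rewrite ger0_norm ?flat_ge0//; apply: le_trans (flat_le _ _) _.
    rewrite -ler_pdivlMl ?ltr0n ?fact_gt0// mulrC.
    near: h; apply: dnbhs0_le.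
    by rewrite mulr_gt0// invr_gt0 ltr0n fact_gt0.
  apply: DeriveDef; [by apply/cvg_ex; exists 0|exact/cvg_lim].
Unshelve. all: by end_near. Qed.

Lemma is_derive_coord_rV d (i : 'I_d) (x v : 'rV[R]_d) :
  is_derive x v (fun x : 'rV[R]_d => x ord0 i : R) (v ord0 i).
Proof.
have cv : h^-1 *: (((fun x : 'rV[R]_d => x ord0 i : R) \o shift x) (h *: v) -
    x ord0 i) @[h --> 0^'] --> v ord0 i.
  apply: (@cvg_trans _ ((fun=> v ord0 i) @ 0^')); last exact: cvg_cst.
  apply: near_eq_cvg; near=> h; rewrite /= !mxE addrK /GRing.scale/= mulKf//.
  by near: h; exact: nbhs_dnbhs_neq.
apply: DeriveDef; [by apply/cvg_ex; exists (v ord0 i)|exact/cvg_lim].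
Unshelve. all: by end_near. Qed.

Lemma smooth_flat_comp d (s a : R) (i : 'I_d) (n : nat) :
  smooth (fun x : 'rV[R]_d => flat n (s * x ord0 i + a)).
Proof.
apply/smoothP => m.
pose g (x : 'rV[R]_d) : R := s * x ord0 i + a.
have dg x : differentiable g x.
  apply: differentiableD => //.
  by apply: differentiableM => //; exact: differentiable_coord.
have df k x : differentiable (flat k) x.
  by apply/derivable1_diffP; have [] := is_derive_flat k x.
have dc k x : differentiable (flat k \o g) x by exact: differentiable_comp.
have pE k j : pderiv j (flat k \o g) = (fun x => (s * (j == i)%:R) *
   (- k%:R * (flat k.+1 \o g) x + (flat k.+2 \o g) x)).
  apply/funext => x; rewrite /pderiv deriveE// diff_comp//= diff1E//=.
  have dgv : is_derive x (delta_mx ord0 j) g (s * (j == i)%:R).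
    have c := is_derive_coord_rV i x (delta_mx ord0 j).
    apply: is_derive_eq.
    by rewrite addr0 mxE eqxx eq_sym.
  by rewrite -deriveE// derive_val derive1E (@derive_val _ _ _ _ _ _ _ (is_derive_flat k (g x))).
elim: m n => [|m IH] n; first exact: dc.
split; first exact: dc.
move=> j; rewrite -/(flat n \o g) pE.
apply: diffnM; first exact: (@diffn_cst _ _ m (s * _)).
apply: diffnD; last exact: IH.
apply: diffnM; first exact: (@diffn_cst _ _ m (- _)).
exact: IH.
Qed.

Definition box_bump d (c : 'rV[R]_d) (r : R) (x : 'rV[R]_d) : R :=
  \prod_i (flat 0 (x ord0 i - c ord0 i + r) * flat 0 (c ord0 i + r - x ord0 i)).

Lemma smooth_box_bump d (c : 'rV[R]_d) r : smooth (box_bump c r).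
Proof.
apply: smooth_prod => i; apply: smoothM.
  rewrite (_ : (fun x => _) = (fun x : 'rV[R]_d => flat 0 (1 * x ord0 i + (r - c ord0 i)))).
    exact: smooth_flat_comp.
  by apply/funext => x; rewrite mul1r addrA addrAC.
rewrite (_ : (fun x => _) = (fun x : 'rV[R]_d => flat 0 (-1 * x ord0 i + (c ord0 i + r)))).
  exact: smooth_flat_comp.
by apply/funext => x; rewrite mulN1r addrC.
Qed.

Lemma box_bump_ge0 d (c : 'rV[R]_d) r x : 0 <= box_bump c r x.
Proof. by apply: prodr_ge0 => i _; rewrite mulr_ge0 ?flat_ge0. Qed.

Lemma box_bump_le1 d (c : 'rV[R]_d) r x : box_bump c r x <= 1.
Proof.
apply: prodr_ile1 => i _.
by rewrite mulr_ge0 ?flat_ge0//= mulr_ile1 ?flat_ge0 ?flat0_le1.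
Qed.

Lemma box_bump_gt0 d (c : 'rV[R]_d) r x : ball c r x -> 0 < box_bump c r x.
Proof.
move=> [r0 /(_ ord0) cx]; apply: prodr_gt0 => i _.
have := cx i; rewrite /ball/= ltr_norml => /andP[h1 h2].
by rewrite mulr_gt0// flat0_gt0//; lra.
Qed.

Lemma box_bump_out d (c : 'rV[R]_d) r x : 0 < r -> ~ ball c r x -> box_bump c r x = 0.
Proof.
move=> r0; rewrite in_ball_rV// => /existsNP[i /negP]; rewrite -leNgt => h.
rewrite /box_bump (bigD1 i)//=.
suff -> : flat 0 (x ord0 i - c ord0 i + r) * flat 0 (c ord0 i + r - x ord0 i) = 0.
  by rewrite mul0r.
move: h; rewrite ler_normr => /orP[h|h].
  by rewrite /flat [X in X * _]ifF ?mul0r//; apply/negbTE; rewrite -leNgt; lra.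
by rewrite /flat [X in _ * X]ifF ?mulr0//; apply/negbTE; rewrite -leNgt; lra.
Qed.

End bump.

Section test_functions.
Context {R : realType} {d : nat}.
Implicit Types (U A : set 'rV[R]_d) (phi psi : 'rV[R]_d -> R).

Lemma test_functionP U phi : test_function U phi <->
  smooth phi /\ exists K, [/\ compact K, K `<=` U & forall x, ~ K x -> phi x = 0].
Proof.
split=> [[sphi cphi phiU]|[sphi [K [cK KU phiK]]]].
  split=> //; exists (closure [set x | phi x != 0]); split=> // x nx.
  by apply/eqP/negPn/negP => phix; apply: nx; apply: subset_closure.
have clK : closed K by apply: compact_closed => //; exact: norm_hausdorff.
have sub : closure [set x | phi x != 0] `<=` K.
  rewrite [X in _ `<=` X](closure_id K).1//; apply: closure_subset => x /= px.
  by apply: contrapT => /phiK; apply/eqP.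
split=> //; last exact: subset_trans KU.
by apply: subclosed_compact cK sub; exact: closed_closure.
Qed.

Lemma test_function_continuous U phi : test_function U phi -> continuous phi.
Proof. by move=> [sphi _ _] x; exact/differentiable_continuous/(sphi [::]). Qed.

Lemma test_function_out U phi x : test_function U phi -> ~ U x -> phi x = 0.
Proof. by move=> /test_functionP[_ [K [_ KU phiK]]] Ux; apply: phiK => /KU. Qed.

Lemma test_functionS U A phi : U `<=` A -> test_function U phi -> test_function A phi.
Proof. by move=> UA [? ? h]; split=> //; exact: subset_trans UA. Qed.

Lemma test_function_bounded U phi : test_function U phi ->
  exists2 M, 0 <= M & forall x, `|phi x| <= M.
Proof.
move=> tphi; have cphi := test_function_continuous tphi.
move/test_functionP : tphi => [_ [K [cK _ phiK]]].
have : compact (phi @` K).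
  by apply: continuous_compact => //; apply: continuous_subspaceT.
move=> /compact_bounded[M [_ MP]].
exists (Num.max 0 (M + 1)) => [|x]; first by rewrite le_max lexx.
rewrite le_max; have [Kx|Kx] := pselect (K x); last by rewrite phiK// normr0 lexx.
by apply/orP; right; apply: (MP (M + 1)); [rewrite ltrDl|exists x].
Qed.

Lemma test_functionD U phi psi : test_function U phi -> test_function U psi ->
  test_function U (fun x => phi x + psi x).
Proof.
move=> /test_functionP[sphi [K [cK KU phiK]]] /test_functionP[spsi [K' [cK' KU' psiK]]].
apply/test_functionP; split; first exact: smoothD.
exists (K `|` K'); split=> [||x /not_orP[nK nK']].
- exact: compactU.
- by rewrite subUset.
- by rewrite phiK// psiK// addr0.
Qed.

Lemma test_functionZ U (a : R) phi : test_function U phi ->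
  test_function U (fun x => a * phi x).
Proof.
move=> /test_functionP[sphi [K [cK KU phiK]]].
apply/test_functionP; split; first exact: smoothM (smooth_cst a) sphi.
by exists K; split=> // x nK; rewrite phiK// mulr0.
Qed.

Lemma test_function0 U : test_function U (fun=> 0).
Proof.
apply/test_functionP; split; first exact: smooth_cst.
by exists set0; split => //; exact: compact0.
Qed.

Lemma test_function_pderiv U i phi : test_function U phi -> test_function U (pderiv i phi).
Proof.
move=> /test_functionP[sphi [K [cK KU phiK]]].
apply/test_functionP; split; first exact: smooth_pderiv.
exists K; split=> // x nK.
have clK : closed K by apply: compact_closed => //; exact: norm_hausdorff.
rewrite /pderiv (@near_eq_derive _ _ _ phi (cst 0)) ?derive_cst//.
have : nbhs x (~` K) by apply: open_nbhs_nbhs; split=> //; exact: closed_openC.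
by apply: filterS => y /phiK.
Qed.

End test_functions.

Section approximation_open.
Context {R : realType} {d : nat}.
Implicit Types (U A : set 'rV[R]_d) (phi psi : 'rV[R]_d -> R) (h : 'rV[R]_d).

Lemma bounded_compact_closure A : bounded_set A -> compact (closure A).
Proof.
move=> [M [_ AM]]; apply: bounded_closed_compact; last exact: closed_closure.
exists (M + 2); split=> [|y My x cAx]; first exact: num_real.
have [z [Az xz]] := cAx _ (nbhsx_ballx x 1 ltr01).
have zM : `|z| <= M + 1 by apply: AM => //; rewrite ltrDl.
move: xz; rewrite -ball_normE /= => xz.
have := ler_normD (x - z) z; rewrite subrK => /le_trans; apply; lra.
Qed.

Lemma bounded_ball (c : 'rV[R]_d) r : bounded_set (ball c r).
Proof.
exists (`|c| + r); split=> [|y My x]; first exact: num_real.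
rewrite -ball_normE /= => xc.
have := ler_normD (x - c) c; rewrite subrK distrC => /le_trans; apply; lra.
Qed.

Lemma pderiv_shift i phi h :
  pderiv i (fun x => phi (x + h)) = (fun x => pderiv i phi (x + h)).
Proof.
apply/funext => x; rewrite /pderiv /derive.
suff -> : (fun k : R => k^-1 *: (((fun y => phi (y + h)) \o shift x) (k *: delta_mx ord0 i) - phi (x + h))) =
   (fun k => k^-1 *: ((phi \o shift (x + h)) (k *: delta_mx ord0 i) - phi (x + h))) by [].
by apply/funext => k /=; rewrite addrA.
Qed.

Lemma smooth_shift phi h : smooth phi -> smooth (fun x => phi (x + h)).
Proof.
move=> sphi s x.
have -> : foldr pderiv (fun x => phi (x + h)) s = (fun x => foldr pderiv phi s (x + h)).
  by elim: s => //= i s ->; rewrite pderiv_shift.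
exact: (@differentiable_comp _ _ _ _ (fun x => x + h) (foldr pderiv phi s)).
Qed.

Lemma test_function_shift U A phi h : test_function A phi ->
  (forall x, A x -> U (x - h)) -> test_function U (fun x => phi (x + h)).
Proof.
move=> /test_functionP[sphi [K [cK KA phiK]]] AU.
apply/test_functionP; split; first exact: smooth_shift.
exists ((fun x => x - h) @` K); split => [|_ [x Kx <-]|x nK].
- apply: continuous_compact => //; apply: continuous_subspaceT => x.
  by apply: (@continuousB _ _ _ id (cst h)) => //; exact: cst_continuous.
- exact/AU/KA.
- by apply: phiK => Kxh; apply: nK; exists (x + h) => //; rewrite addrK.
Qed.

(** Take one bump in [0, 1] for each rational ball with closure in [U], and let
    [phi_ n] be one minus the product of the [n]-th powers of [1 - psi j] for
    [j < n]. At a point of [U] some bump is positive, so that the product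
    tends to zero; outside [U] all factors are one. *)
Lemma open_indic_cvg_test_function U : open U ->
  exists phi_ : nat -> 'rV[R]_d -> R,
    [/\ forall n, test_function U (phi_ n), forall n x, 0 <= phi_ n x <= 1 &
        forall x, phi_ n x @[n --> \oo] --> (\1_U x : R)].
Proof.
move=> oU.
pose B (p : 'rV[rat]_d * nat) : set 'rV[R]_d := ball (map_mx ratr p.1 : 'rV[R]_d) p.2.+1%:R^-1.
pose psi (j : nat) (x : 'rV[R]_d) : R := if unpickle j is Some p then
  if `[< closure (B p) `<=` U >] then box_bump (map_mx ratr p.1 : 'rV[R]_d) p.2.+1%:R^-1 x else 0 else 0.
pose K (j : nat) : set 'rV[R]_d := if unpickle j is Some p then
  if `[< closure (B p) `<=` U >] then closure (B p) else set0 else set0.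
have spsi j : smooth (psi j).
  rewrite /psi; case: unpickle => [p|]; last exact: smooth_cst.
  by case: asboolP => _; [exact: smooth_box_bump|exact: smooth_cst].
have psi01 j x : 0 <= psi j x <= 1.
  rewrite /psi; case: unpickle => [p|]; last by rewrite lexx ler01.
  by case: asboolP => _; rewrite ?lexx ?ler01// box_bump_ge0 box_bump_le1.
have psiK j x : ~ K j x -> psi j x = 0.
  rewrite /psi /K; case: unpickle => [p|//]; case: asboolP => //= _ nK.
  by apply: box_bump_out => // Bx; apply: nK; exact: subset_closure.
have KU j : K j `<=` U.
  rewrite /K; case: unpickle => [p|]; last exact: sub0set.
  by case: asboolP => // _; exact: sub0set.
have cK j : compact (K j).
  rewrite /K; case: unpickle => [p|]; last exact: compact0.
  case: asboolP => _; last exact: compact0.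
  exact/bounded_compact_closure/bounded_ball.
pose phi_ n (x : 'rV[R]_d) := 1 - \prod_(j < n) (1 - psi j x) ^+ n.
have prod01 n x : 0 <= \prod_(j < n) (1 - psi j x) ^+ n <= 1.
  rewrite prodr_ge0 => [|j _]; last by rewrite exprn_ge0// subr_ge0; have /andP[] := psi01 j x.
  apply: prodr_ile1 => j _; have /andP[p0 p1] := psi01 j x.
  by rewrite exprn_ge0 ?subr_ge0//= exprn_ile1 ?subr_ge0// lerBlDr lerDl.
exists phi_; split => [n|n x|x].
- apply/test_functionP; split.
    rewrite /phi_; apply: smoothD; first exact: smooth_cst.
    rewrite (_ : (fun x => _) = (fun x => (-1) * \prod_(j < n) (1 - psi j x) ^+ n)); last first.
      by apply/funext => x; rewrite mulN1r.
    apply: smoothM; first exact: smooth_cst.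
    apply: smooth_prod => j; apply: smooth_exp; apply: smoothD; first exact: smooth_cst.
    rewrite (_ : (fun x => _) = (fun x => (-1) * psi j x)); last first.
      by apply/funext => x; rewrite mulN1r.
    by apply: smoothM => //; exact: smooth_cst.
  exists (\big[setU/set0]_(j < n) K j); split.
  + by apply: bigsetU_compact.
  + by rewrite -bigcup_mkord => x [j _]; exact: KU.
  + rewrite -bigcup_mkord => x nK; rewrite /phi_ big1 ?subrr// => j _.
    by rewrite psiK ?subr0 ?expr1n// => Kx; apply: nK; exists j => /=.
- by have /andP[p0 p1] := prod01 n x; rewrite /phi_ subr_ge0 p1 lerBlDr lerDl p0.
- have [Ux|nUx] := pselect (U x); last first.
    rewrite indicE memNset// (_ : (fun n => _) = fun=> 0); first exact: cvg_cst.
    apply/funext => n; rewrite /phi_ big1 ?subrr// => j _.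
    by rewrite psiK ?subr0 ?expr1n// => /KU.
  have [c [k [cx cU]]] := open_rat_ball oU Ux.
  have psix : 0 < psi (pickle (c, k)) x.
    by rewrite /psi pickleK asboolT//; exact: box_bump_gt0.
  set a := psi _ x in psix.
  have /andP[a0 a1] := psi01 (pickle (c, k)) x; rewrite -/a in a0 a1.
  rewrite indicE mem_set// -[X in _ --> X]subr0 /phi_; apply: cvgB; first exact: cvg_cst.
  have ca : (1 - a) ^+ n @[n --> \oo] --> (0 : R).
    by apply: cvg_expr; rewrite ger0_norm ?subr_ge0// ltrBlDr ltrDl.
  apply: (@squeeze_cvgr _ _ _ _ (cst 0) (fun n => (1 - a) ^+ n)) => //; last exact: cvg_cst.
  near=> n; have /andP[-> _] /= := prod01 n x.
  have jn : (pickle (c, k) < n)%N by near: n; exact: nbhs_infty_gt.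
  rewrite (bigD1 (Ordinal jn))//= -/a ler_piMr//; first by rewrite exprn_ge0// subr_ge0.
  apply: prodr_ile1 => j _; have /andP[p0 p1] := psi01 j x.
  by rewrite exprn_ge0 ?subr_ge0//= exprn_ile1 ?subr_ge0// lerBlDr lerDl.
Unshelve. all: by end_near. Qed.

End approximation_open.

(** * The space L2 over a measurable set *)

Section L2_space.
Context {R : realType} {d : nat}.
Local Notation mu := (@lebesgue_rV R d).
Implicit Types (A B : set 'rV[R]_d) (f g h : 'rV[R]_d -> R).

Definition L2ip A f g : R := \int[mu]_(x in A) (f x * g x).

Lemma L2P A f : measurable A -> L2 A f <->
  measurable_fun A f /\ mu.-integrable A (EFin \o (fun x => f x ^+ 2)).
Proof.
move=> mA; split.
  move=> fL2; split.
    apply/measurable_restrictT => //.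
    by move: fL2; rewrite /L2 inE => /andP[/[!inE]].
  apply/(integrable_mkcond _ mA); have := Lfun2_integrable_sqr fL2.
  congr (mu.-integrable _ _); apply/funext => x /=.
  by rewrite /patch; case: ifP => // _; rewrite expr0n.
move=> [mf fi]; rewrite /L2 inE; apply/andP; split; rewrite inE/=.
  by move/(measurable_restrictT _ mA).1 : mf.
rewrite /finite_norm unlock; apply: poweR_lty.
move/(integrable_mkcond _ mA) : fi => /integrableP[_]; apply: le_lt_trans.
rewrite le_eqVlt; apply/orP; left; apply/eqP; apply: eq_integral => x _ /=.
rewrite /patch; case: ifP => _ /=.
  by rewrite powR_mulrn// normrX.
by rewrite -[point]/(0 : R) !normr0 powR_mulrn// expr0n.
Qed.

Lemma L2_measurable A f : measurable A -> L2 A f -> measurable_fun A f.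
Proof. by move=> mA /(L2P _ mA)[]. Qed.

Lemma L2ip_integrable A f g : measurable A -> L2 A f -> L2 A g ->
  mu.-integrable A (EFin \o (fun x => f x * g x)).
Proof.
move=> mA /(L2P _ mA)[mf fi] /(L2P _ mA)[mg gi].
apply: (le_integrable mA _ _ (integrableD mA fi gi)) => /=.
  by apply/measurable_EFinP; exact: measurable_funM.
move=> x _ /=; rewrite lee_fin (@ger0_norm _ (_ + _)) ?addr_ge0 ?sqr_ge0// ler_norml.
by have := sqr_ge0 (f x + g x); have := sqr_ge0 (f x - g x); nra.
Qed.

Lemma L2D A f g : measurable A -> L2 A f -> L2 A g -> L2 A (fun x => f x + g x).
Proof.
move=> mA fL gL; have /(L2P _ mA)[mf fi] := fL; have /(L2P _ mA)[mg gi] := gL.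
apply/(L2P _ mA); split; first exact: measurable_funD.
apply: (le_integrable mA _ _ (integrableD mA (integrableD mA fi fi) (integrableD mA gi gi))) => /=.
  apply/measurable_EFinP; apply: (@measurable_funX _ _ _ _ (fun x => f x + g x)).
  exact: measurable_funD.
move=> x _ /=; rewrite lee_fin !ger0_norm ?addr_ge0 ?sqr_ge0//.
by have := sqr_ge0 (f x - g x); nra.
Qed.

Lemma L2Z A (a : R) f : measurable A -> L2 A f -> L2 A (fun x => a * f x).
Proof.
move=> mA /(L2P _ mA)[mf fi]; apply/(L2P _ mA); split; first exact: measurable_funM.
have := integrableZl mA (a ^+ 2) fi; congr (mu.-integrable _ _).
by apply/funext => x /=; rewrite exprMn.
Qed.

Lemma L2N A f : measurable A -> L2 A f -> L2 A (fun x => - f x).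
Proof.
move=> mA fL; have := @L2Z A (-1) f mA fL.
by congr L2; apply/funext => x; rewrite mulN1r.
Qed.

Lemma L2B A f g : measurable A -> L2 A f -> L2 A g -> L2 A (fun x => f x - g x).
Proof. by move=> mA fL gL; apply: L2D => //; exact: L2N. Qed.

Lemma L2S A B f : measurable A -> measurable B -> A `<=` B -> L2 B f -> L2 A f.
Proof.
move=> mA mB AB /(L2P _ mB)[mf fi]; apply/(L2P _ mA); split.
  exact: measurable_funS mf.
exact: integrableS fi.
Qed.

Lemma L2_bounded A f M : measurable A -> (mu A < +oo)%E -> measurable_fun A f ->
  (forall x, A x -> `|f x| <= M) -> L2 A f.
Proof.
move=> mA Afin mf fM; apply/(L2P _ mA); split => //.
have ci : mu.-integrable A (EFin \o (fun _ : 'rV[R]_d => M ^+ 2)).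
  apply/integrableP; split; first exact/measurable_EFinP.
  rewrite /= (_ : (fun _ => _) = cst (`|M ^+ 2|%:E))// integral_cst//.
  by rewrite lte_mul_pinfty.
apply: (le_integrable mA _ _ ci) => /=.
  by apply/measurable_EFinP; exact: measurable_funX.
move=> x Ax /=; rewrite lee_fin !normrX lerXn2r ?nnegrE//.
by apply: le_trans (fM x Ax) _; rewrite ler_norm.
Qed.

Lemma L2_le A f g : measurable A -> measurable_fun A f -> L2 A g ->
  (forall x, A x -> `|f x| <= `|g x|) -> L2 A f.
Proof.
move=> mA mf /(L2P _ mA)[mg gi] fg; apply/(L2P _ mA); split=> //.
apply: (le_integrable mA _ _ gi) => /=.
  by apply/measurable_EFinP; exact: measurable_funX.
by move=> x Ax; rewrite lee_fin !normrX lerXn2r ?nnegrE// fg.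
Qed.

Lemma L2_cst A (c : R) : measurable A -> (mu A < +oo)%E -> L2 A (fun=> c).
Proof. by move=> mA finA; apply: (@L2_bounded _ _ `|c|). Qed.

Lemma eq_L2 A f g : {in A, f =1 g} -> L2 A f -> L2 A g.
Proof.
move=> fg; rewrite /L2; suff -> : f \_ A = g \_ A by [].
by apply/funext => x; rewrite /patch; case: ifP => // /fg.
Qed.

Lemma eq_L2ip A f f' g g' : {in A, f =1 f'} -> {in A, g =1 g'} ->
  L2ip A f g = L2ip A f' g'.
Proof. by move=> ff gg; apply: eq_Rintegral => x xA; rewrite ff// gg. Qed.

Lemma L2ipC A f g : L2ip A f g = L2ip A g f.
Proof. by apply: eq_Rintegral => x _; rewrite mulrC. Qed.

Lemma L2ipDl A f g h : measurable A -> L2 A f -> L2 A g -> L2 A h ->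
  L2ip A (fun x => f x + g x) h = L2ip A f h + L2ip A g h.
Proof.
move=> mA fL gL hL; rewrite /L2ip -RintegralD//; [|exact: L2ip_integrable..].
by apply: eq_Rintegral => x _; rewrite mulrDl.
Qed.

Lemma L2ipZl A (a : R) f h : measurable A -> L2 A f -> L2 A h ->
  L2ip A (fun x => a * f x) h = a * L2ip A f h.
Proof.
move=> mA fL hL; rewrite /L2ip -RintegralZl//; last exact: L2ip_integrable.
by apply: eq_Rintegral => x _; rewrite mulrA.
Qed.

Lemma L2ipBl A f g h : measurable A -> L2 A f -> L2 A g -> L2 A h ->
  L2ip A (fun x => f x - g x) h = L2ip A f h - L2ip A g h.
Proof.
move=> mA fL gL hL; rewrite /L2ip -RintegralB//; [|exact: L2ip_integrable..].
by apply: eq_Rintegral => x _; rewrite mulrBl.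
Qed.

Lemma L2ip_ge0 A f : 0 <= L2ip A f f.
Proof. by apply: Rintegral_ge0 => x _; rewrite -expr2 sqr_ge0. Qed.

Lemma L2normE A f : measurable A -> L2norm A f = Num.sqrt (L2ip A f f).
Proof.
move=> mA; rewrite /L2norm unlock.
have -> : (\int[mu]_x `|(EFin \o f \_ A) x| `^ 2 = \int[mu]_(x in A) (f x * f x)%:E)%E.
  rewrite [RHS]integral_mkcond; apply: eq_integral => x _.
  rewrite /= /patch; case: ifP => _ /=.
    by rewrite powR_mulrn// real_normK ?num_real// expr2.
  by rewrite -[point]/(0 : R) !normr0 powR_mulrn// expr0n.
rewrite /L2ip /Rintegral; set I := integral _ _ _.
have : (0 <= I)%E by apply: integral_ge0 => x _; rewrite lee_fin -expr2 sqr_ge0.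
case: I => [r||//]; first by rewrite lee_fin => r0 /=; rewrite powR12_sqrt.
by move=> _; rewrite poweRyr ?invr_neq0//= sqrtr0.
Qed.

Lemma L2norm_ge0 A f : 0 <= L2norm A f.
Proof. by rewrite /L2norm fine_ge0// Lnorm_ge0. Qed.

Lemma L2norm_sqr A f : measurable A -> L2norm A f ^+ 2 = L2ip A f f.
Proof. by move=> mA; rewrite L2normE// sqr_sqrtr// L2ip_ge0. Qed.

Lemma eq_L2norm A f g : {in A, f =1 g} -> L2norm A f = L2norm A g.
Proof.
move=> fg; rewrite /L2norm; suff -> : f \_ A = g \_ A by [].
by apply/funext => x; rewrite /patch; case: ifP => // /fg.
Qed.

Lemma L2norm_quad A f g (t : R) : measurable A -> L2 A f -> L2 A g ->
  L2norm A (fun x => f x + t * g x) ^+ 2 =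
  L2norm A f ^+ 2 + t * (L2ip A f g *+ 2) + t ^+ 2 * L2norm A g ^+ 2.
Proof.
move=> mA fL gL; rewrite !L2norm_sqr//.
have tL := L2Z t mA gL.
rewrite L2ipDl//; last exact: L2D.
rewrite L2ipZl//; last exact: L2D.
rewrite (L2ipC _ f) (L2ipC _ g) L2ipDl// L2ipDl// !L2ipZl// (L2ipC _ g f).
ring.
Qed.

(** The discriminant of a nonnegative quadratic polynomial is nonpositive. *)
Lemma quadratic_ge0_le (a b c : R) : 0 <= a -> 0 <= b ->
  (forall t, 0 <= a ^+ 2 + t * (c *+ 2) + t ^+ 2 * b ^+ 2) -> `|c| <= a * b.
Proof.
move=> a0 b0 quad.
rewrite -(@ler_pXn2r _ 2) ?nnegrE ?mulr_ge0// real_normK ?num_real//.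
have [b_eq0|b_neq0] := eqVneq b 0.
  have [->|c0] := eqVneq c 0; first by rewrite expr0n/= sqr_ge0.
  have := quad (- (a ^+ 2 + 1) / (c *+ 2)).
  rewrite mulfVK ?mulrn_eq0// b_eq0 expr0n/= mulr0 addr0; lra.
have b2 : 0 < b ^+ 2 by rewrite exprn_gt0// lt_neqAle eq_sym b_neq0.
have := quad (- c / b ^+ 2).
have -> : a ^+ 2 + - c / b ^+ 2 * (c *+ 2) + (- c / b ^+ 2) ^+ 2 * b ^+ 2 =
    (a ^+ 2 * b ^+ 2 - c ^+ 2) / b ^+ 2 by field.
by rewrite pmulr_lge0 ?invr_gt0// subr_ge0 exprMn.
Qed.

Lemma L2ip_le A f g : measurable A -> L2 A f -> L2 A g ->
  `|L2ip A f g| <= L2norm A f * L2norm A g.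
Proof.
move=> mA fL gL; apply: quadratic_ge0_le; [exact: L2norm_ge0..|] => t.
by rewrite -L2norm_quad// sqr_ge0.
Qed.

Lemma L2normD A f g : measurable A -> L2 A f -> L2 A g ->
  L2norm A (fun x => f x + g x) <= L2norm A f + L2norm A g.
Proof.
move=> mA fL gL; rewrite -(@ler_pXn2r _ 2) ?nnegrE ?addr_ge0 ?L2norm_ge0//.
have := L2norm_quad 1 mA fL gL.
rewrite (@eq_L2norm _ _ (fun x => f x + g x)); last by move=> x _; rewrite mul1r.
move=> ->; have := le_trans (ler_norm _) (L2ip_le mA fL gL); lra.
Qed.

Lemma L2normZ A (a : R) f : measurable A -> L2 A f ->
  L2norm A (fun x => a * f x) = `|a| * L2norm A f.
Proof.
move=> mA fL; rewrite !L2normE// L2ipZl//; last exact: L2Z.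
by rewrite L2ipC L2ipZl// mulrA -expr2 sqrtrM ?sqr_ge0// sqrtr_sqr.
Qed.

Lemma L2normBC A f g : measurable A ->
  L2norm A (fun x => f x - g x) = L2norm A (fun x => g x - f x).
Proof.
move=> mA; rewrite !L2normE//; congr Num.sqrt; apply: eq_Rintegral => x _; ring.
Qed.

Lemma L2norm_triangle A f g : measurable A -> L2 A f -> L2 A g ->
  `|L2norm A f - L2norm A g| <= L2norm A (fun x => f x - g x).
Proof.
move=> mA fL gL; have bL := L2B mA fL gL; have cL := L2B mA gL fL.
rewrite ler_norml lerBrDr lerBlDr; apply/andP; split.
  have := L2normD mA cL fL; rewrite (@eq_L2norm _ _ g); last by move=> x _; rewrite subrK.
  rewrite L2normBC//; lra.
have := L2normD mA bL gL; rewrite (@eq_L2norm _ _ f); last by move=> x _; rewrite subrK.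
lra.
Qed.

Lemma L2norm0 A : L2norm A (fun=> 0) = 0.
Proof.
rewrite /L2norm (_ : _ \_ A = cst 0).
  by rewrite (_ : EFin \o _ = cst 0%E)// Lnorm0.
by apply/funext => x; rewrite /patch; case: ifP.
Qed.

Lemma L2norm_subset A B f : measurable A -> measurable B -> A `<=` B -> L2 B f ->
  L2norm A f <= L2norm B f.
Proof.
move=> mA mB AB fL; rewrite !L2normE// ler_sqrt ?L2ip_ge0//.
have i := L2ip_integrable mB fL fL; have iA := integrableS mB mA AB i.
rewrite /L2ip /Rintegral fine_le//.
- exact: integrable_fin_num.
- exact: integrable_fin_num.
- apply: ge0_subset_integral => //; first by case/integrableP: i.
  by move=> x _; rewrite lee_fin -expr2 sqr_ge0.
Qed.

Lemma L2norm_ae A f g : measurable A -> L2 A f -> L2 A g ->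
  ae_eq mu A f g -> L2norm A f = L2norm A g.
Proof.
move=> mA fL gL fg; rewrite !L2normE//; congr Num.sqrt; congr fine.
have := L2ip_integrable mA fL fL => /integrableP[mf _].
have := L2ip_integrable mA gL gL => /integrableP[mg _].
apply: ae_eq_integral => //.
by apply: filterS fg => x /= h Ax; rewrite h.
Qed.

Lemma integral_sqr_L2norm A f : measurable A -> L2 A f ->
  (\int[mu]_(x in A) (f x ^+ 2)%:E = (L2norm A f ^+ 2)%:E)%E.
Proof.
move=> mA fL; rewrite L2norm_sqr// /L2ip /Rintegral fineK; last first.
  by apply: integrable_fin_num => //; exact: L2ip_integrable.
by apply: eq_integral => x _; rewrite expr2.
Qed.

Lemma L2norm_setU A B f : measurable A -> measurable B -> L2 (A `|` B) f ->
  L2norm (A `|` B) f <= L2norm A f + L2norm B f.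
Proof.
move=> mA mB fL; have mAB := measurableU _ _ mA mB.
have fA : L2 A f by apply: L2S fL => //; exact: subsetUl.
have fB : L2 B f by apply: L2S fL => //; exact: subsetUr.
rewrite -(@ler_pXn2r _ 2) ?nnegrE ?addr_ge0 ?L2norm_ge0//.
apply: (@le_trans _ _ (L2norm A f ^+ 2 + L2norm B f ^+ 2)); last first.
  by have := L2norm_ge0 A f; have := L2norm_ge0 B f; nra.
rewrite -lee_fin EFinD -!integral_sqr_L2norm//.
have mf : measurable_fun (A `|` B) (fun x => (f x ^+ 2)%:E).
  by apply/measurable_EFinP/measurable_funX; exact: L2_measurable fL.
have AB : A `|` B = A `|` (B `\` A).
  apply/seteqP; split => x [Ax|]; [by left| |by left|by case; right].
  by have [Ax _|nA Bx] := pselect (A x); [left|right].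
rewrite AB in mf *; have mD := measurableD mB mA.
have dis : [disjoint A & B `\` A].
  by apply/disj_set2P; rewrite setIC setDE -setIA setICl setI0.
have f0 x : (A `|` (B `\` A)) x -> (0 <= (f x ^+ 2)%:E)%E by rewrite lee_fin sqr_ge0.
rewrite (ge0_integral_setU mu mA mD mf f0 dis).
have mfB : measurable_fun B (fun x => (f x ^+ 2)%:E).
  by apply/measurable_EFinP/measurable_funX; exact: L2_measurable fB.
rewrite leeD2l//; apply: ge0_subset_integral => // x _.
by rewrite lee_fin sqr_ge0.
Qed.

Lemma L2_sumr (I : Type) (r : seq I) A (F : I -> 'rV[R]_d -> R) :
  measurable A -> L2 A (fun=> 0) -> (forall i, L2 A (F i)) ->
  L2 A (fun x => \sum_(i <- r) F i x).
Proof.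
move=> mA L0 FL; elim: r => [|i r IH]; first by under eq_fun do rewrite big_nil.
by under eq_fun do rewrite big_cons; exact: L2D.
Qed.

Lemma L2ip_sumr (I : Type) (r : seq I) A f (F : I -> 'rV[R]_d -> R) :
  measurable A -> L2 A f -> (forall i, L2 A (F i)) ->
  L2ip A f (fun x => \sum_(i <- r) F i x) = \sum_(i <- r) L2ip A f (F i).
Proof.
move=> mA fL FL.
have L0 : L2 A (fun=> 0) by apply: (@L2_le _ _ f) => // x _; rewrite normr0.
elim: r => [|i r IH].
  rewrite big_nil /L2ip; under eq_Rintegral do rewrite big_nil mulr0.
  by rewrite Rintegral_cst// mul0r.
have sL := L2_sumr r mA L0 FL.
rewrite big_cons -IH [in RHS]L2ipC (L2ipC _ f (fun x => \sum_(_ <- r) _)) -L2ipDl// L2ipC.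
by apply: eq_Rintegral => x _; rewrite big_cons.
Qed.

End L2_space.

(** * Density of test functions *)

Section test_functions_dense.
Import HBNNSimple.
Context {R : realType} {d : nat}.
Local Notation mu := (@lebesgue_rV R d).
Implicit Types (A B : set 'rV[R]_d) (f g h phi : 'rV[R]_d -> R).

Lemma L2norm_dominated_cvg A (f_ : nat -> 'rV[R]_d -> R) f g : measurable A ->
  (forall n, L2 A (f_ n)) -> L2 A f -> L2 A g ->
  (forall n x, A x -> `|f x - f_ n x| <= `|g x|) ->
  (forall x, A x -> f_ n x @[n --> \oo] --> f x) ->
  L2norm A (fun x => f x - f_ n x) @[n --> \oo] --> 0.
Proof.
move=> mA f_L fL gL fg ff.
have dL n := L2B mA fL (f_L n).
have cvg2 : L2norm A (fun x => f x - f_ n x) ^+ 2 @[n --> \oo] --> 0.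
  pose F n x := ((f x - f_ n x) ^+ 2)%:E.
  have mF n : measurable_fun A (F n).
    by apply/measurable_EFinP/measurable_funX; exact: (L2_measurable mA (dL n)).
  have cF x : A x -> F n x @[n --> \oo] --> (cst 0%E x : \bar R).
    move=> Ax; rewrite /F/=; apply: cvg_EFin; first exact: nearW.
    have h : f x - f_ n x @[n --> \oo] --> (0 : R).
      by rewrite -(subrr (f x)); apply: cvgB; [exact: cvg_cst|exact: ff].
    rewrite /comp/=; under eq_fun do rewrite expr2.
    by have := cvgM h h; rewrite mulr0; exact.
  have [_ gi] := (L2P g mA).1 gL.
  have [||||_ _] := @dominated_convergence _ _ _ mu _ mA F (cst 0%E)
    (EFin \o (fun x => g x ^+ 2)) mF.
  - exact: measurable_cst.
  - exact: aeW.
  - exact: gi.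
  - apply: aeW => x n Ax; rewrite /F lee_fin normrX.
    by rewrite -(real_normK (num_real (g x))) lerXn2r ?nnegrE// fg.
  rewrite integral0 => /fine_cvg h.
  rewrite (_ : (fun n => _) = fine \o (fun n => \int[mu]_(x in A) F n x)%E)//.
  apply/funext => n /=; rewrite L2norm_sqr//.
apply/cvgrPdist_lt => e e0.
move/cvgrPdist_lt : cvg2 => /(_ (e ^+ 2) (exprn_gt0 _ e0)); apply: filterS => n.
rewrite !sub0r !normrN ger0_norm ?sqr_ge0// ger0_norm ?L2norm_ge0//.
by rewrite ltr_pXn2r ?nnegrE ?L2norm_ge0 ?ltW.
Qed.

Section dense.
Variable A : set 'rV[R]_d.
Hypotheses (oA : open A) (finA : (mu A < +oo)%E).
Let mA : measurable A := open_measurable_rV oA.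

Lemma test_function_L2 U phi : test_function U phi -> L2 A phi.
Proof.
move=> tphi; have [M M0 phiM] := test_function_bounded tphi.
apply: (@L2_bounded _ _ _ _ M) => //.
by apply: measurable_funTS; apply: continuous_measurable_rV; exact: test_function_continuous tphi.
Qed.

Definition L2_approx f := L2 A f /\ forall e : R, 0 < e ->
  exists2 phi, test_function A phi & L2norm A (fun x => f x - phi x) < e.

Lemma eq_L2_approx f g : {in A, f =1 g} -> L2_approx f -> L2_approx g.
Proof.
move=> fg [fL fa]; split; first exact: eq_L2 fL.
move=> e /fa[phi tphi h]; exists phi => //; rewrite (@eq_L2norm _ _ _ _ (fun x => f x - phi x))//.
by move=> x xA; rewrite fg.
Qed.

Lemma L2_approx_test phi : test_function A phi -> L2_approx phi.
Proof.
move=> tphi; split; first exact: test_function_L2 tphi.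
move=> e e0; exists phi => //; rewrite (@eq_L2norm _ _ _ _ (fun=> 0)) ?L2norm0//.
by move=> x _; rewrite subrr.
Qed.

Lemma L2_approxD f g : L2_approx f -> L2_approx g -> L2_approx (fun x => f x + g x).
Proof.
move=> [fL fa] [gL ga]; split; first exact: L2D.
move=> e e0; have e2 : 0 < e / 2 by rewrite divr_gt0.
have [phi tphi hphi] := fa _ e2; have [psi tpsi hpsi] := ga _ e2.
exists (fun x => phi x + psi x); first exact: test_functionD.
rewrite (@eq_L2norm _ _ _ _ (fun x => (f x - phi x) + (g x - psi x))); last first.
  by move=> x _; ring.
have := L2normD mA (L2B mA fL (test_function_L2 tphi)) (L2B mA gL (test_function_L2 tpsi)).
by lra.
Qed.

Lemma L2_approxZ (a : R) f : L2_approx f -> L2_approx (fun x => a * f x).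
Proof.
move=> [fL fa]; split; first exact: L2Z.
move=> e e0; have e2 : 0 < e / (`|a| + 1) by rewrite divr_gt0// ltr_wpDl.
have [phi tphi hphi] := fa _ e2; exists (fun x => a * phi x); first exact: test_functionZ.
rewrite (@eq_L2norm _ _ _ _ (fun x => a * (f x - phi x))); last first.
  by move=> x _; ring.
rewrite L2normZ//; last by apply: L2B => //; exact: test_function_L2 tphi.
move: hphi; rewrite ltr_pdivlMr ?ltr_wpDl//; apply: le_lt_trans.
by rewrite mulrC ler_wpM2l ?L2norm_ge0// lerDl.
Qed.

Lemma L2_approx_cvg (f_ : nat -> 'rV[R]_d -> R) f g : (forall n, L2_approx (f_ n)) ->
  L2 A f -> L2 A g ->
  (forall n x, A x -> `|f x - f_ n x| <= `|g x|) ->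
  (forall x, A x -> f_ n x @[n --> \oo] --> f x) -> L2_approx f.
Proof.
move=> fa fL gL fg ff; split=> // e e0; have e2 : 0 < e / 2 by rewrite divr_gt0.
have /cvgrPdist_lt/(_ _ e2)[N _ /(_ N (leqnn N))] :=
  L2norm_dominated_cvg mA (fun n => (fa n).1) fL gL fg ff.
rewrite sub0r normrN ger0_norm ?L2norm_ge0// => hN.
have [fNL /(_ _ e2)[phi tphi hphi]] := fa N.
exists phi => //; rewrite (@eq_L2norm _ _ _ _ (fun x => (f x - f_ N x) + (f_ N x - phi x))); last first.
  by move=> x _; ring.
have := L2normD mA (L2B mA fL fNL) (L2B mA fNL (test_function_L2 tphi)).
by lra.
Qed.

Lemma L2_indic (S : set 'rV[R]_d) : measurable S -> L2 A \1_S.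
Proof.
move=> mS; apply: (@L2_bounded _ _ _ _ 1) => // x _.
by rewrite indicE normr_nat lern1 leq_b1.
Qed.

Lemma indic_dist_le1 (S T : set 'rV[R]_d) x : `|\1_S x - \1_T x| <= `|1 : R|.
Proof.
rewrite !indicE normr1; case: (x \in S); case: (x \in T);
  rewrite ?subrr ?subr0 ?sub0r ?normrN ?normr1 ?normr0//.
Qed.

(** For open sets this is the approximation of indicators from inside; the
    sets with the property are stable under complements and countable disjoint
    unions, so Dynkin's lemma applies. *)
Lemma L2_approx_indic (S : set 'rV[R]_d) : measurable S -> L2_approx \1_S.
Proof.
have L1 : L2 A (fun=> 1 : R) by apply: (@L2_bounded _ _ _ _ 1) => // x _; rewrite normr1.
have openP (U : set 'rV[R]_d) : open U -> L2_approx \1_U.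
  move=> oU; have [phi_ [tphi phi01 phic]] := open_indic_cvg_test_function (openI oU oA).
  apply: (@eq_L2_approx \1_(U `&` A)).
    by move=> x xA; rewrite !indicE in_setI xA andbT.
  have mUA : measurable (U `&` A) by apply: open_measurable_rV; exact: openI.
  apply: (@L2_approx_cvg phi_ _ (fun=> 1)) => // [n||n x Ax].
  - by apply: L2_approx_test; apply: test_functionS (tphi n); exact: subIsetr.
  - exact: L2_indic.
  have /andP[h0 h1] := phi01 n x; rewrite normr1 ler_norml indicE.
  by case: (_ \in _) => /=; lra.
rewrite measurable_rV_open.
apply: (@dynkin_induction _ 'rV[R]_d [set U | open U] (fun S => L2_approx \1_S) (measurable_rV_open d)) => /=.
- by move=> U V oU oV; exact: openI.
- by apply: openP; exact: openT.
- by move=> U; exact: openP.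
- move=> B mB aB; apply: (@eq_L2_approx (fun x => \1_setT x + -1 * \1_B x)).
    by move=> x _; rewrite !indicE in_setT in_setC; case: (_ \in _) => /=; ring.
  apply: L2_approxD; last exact: L2_approxZ.
  by apply: openP; exact: openT.
- move=> F mF tF aF.
  have aU n : L2_approx \1_(\big[setU/set0]_(k < n) F k).
    elim: n => [|n IH].
      by rewrite big_ord0 indic0; apply: L2_approx_test; exact: test_function0.
    rewrite big_ord_recr/=.
    apply: (@eq_L2_approx (fun x => \1_(\big[setU/set0]_(k < n) F k) x + \1_(F n) x)); last exact: L2_approxD.
    move=> x _; rewrite !indicE in_setU.
    have [xF|] := boolP (x \in F n); last by rewrite orbF addr0.
    suff /negbTE -> : x \notin \big[setU/set0]_(k < n) F k by rewrite add0r.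
    apply/negP; rewrite inE -bigcup_mkord => -[k /= kn Fkx].
    move/trivIsetP : tF => /(_ k n Logic.I Logic.I); rewrite ltn_eqF// => /(_ isT).
    by move/seteqP => [/(_ x) + _]; apply; split=> //; exact: set_mem xF.
  apply: (@L2_approx_cvg _ _ (fun=> 1) aU) => // [|n x _|x _].
  + by apply: L2_indic; exact: bigcupT_measurable.
  + exact: indic_dist_le1.
  + have [[k _ Fkx]|nF] := pselect ((\bigcup_k F k) x); last first.
      rewrite indicE memNset// (_ : (fun n => _) = fun=> 0); first exact: cvg_cst.
      apply/funext => n; rewrite indicE memNset// -bigcup_mkord => -[k _ Fkx].
      by apply: nF; exists k.
    apply: cvg_near_cst; near=> n; rewrite !indicE !mem_set//; first by exists k.
    by rewrite -bigcup_mkord; exists k => //=; near: n; exact: nbhs_infty_gt.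
Unshelve. all: by end_near. Qed.

Lemma L2_approx_sum (I : Type) (r : seq I) (F : I -> 'rV[R]_d -> R) :
  (forall i, L2_approx (F i)) -> L2_approx (fun x => \sum_(i <- r) F i x).
Proof.
move=> aF; elim: r => [|i r IH].
  under eq_fun do rewrite big_nil.
  by apply: L2_approx_test; exact: test_function0.
under eq_fun do rewrite big_cons.
exact: L2_approxD.
Qed.

Lemma L2_approx_nonneg f : L2 A f -> (forall x, A x -> 0 <= f x) -> L2_approx f.
Proof.
move=> fL f0; have mf : measurable_fun A (EFin \o f).
  by apply/measurable_EFinP; exact: L2_measurable.
pose g_ := nnsfun_approx mA mf.
have cg x : A x -> g_ n x @[n --> \oo] --> f x.
  move=> Ax; have := @cvg_nnsfun_approx _ _ _ _ mA _ mf (fun x Ax => f0 x Ax) x Ax.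
  by move=> /fine_cvg.
have g0 n x : 0 <= g_ n x by exact: fun_ge0.
have gf n x : A x -> g_ n x <= f x.
  move=> Ax; have /cvgP gc := cg x Ax.
  rewrite -(cvg_lim _ (cg x Ax))//; apply: nondecreasing_cvgn_le => //.
  by move=> m k mk; exact/lefP/nd_nnsfun_approx.
apply: (@L2_approx_cvg g_ _ f) => // [n|n x Ax]; last first.
  by have := gf n x Ax; have := g0 n x; have := f0 x Ax; move=> *; rewrite !ger0_norm ?subr_ge0//; lra.
have -> : (g_ n : 'rV[R]_d -> R) =
    (fun x => \sum_(y <- fset_set (range (g_ n))) y * \1_(g_ n @^-1` [set y]) x).
  by apply/funext => x; rewrite fimfunE fsbig_finite.
apply: L2_approx_sum => y; apply: L2_approxZ; apply: L2_approx_indic.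
exact: measurable_sfunP.
Qed.

Theorem test_function_dense f : L2 A f -> L2_approx f.
Proof.
move=> fL; have mf := L2_measurable mA fL.
have mf' : measurable_fun A (fun x => - f x) by exact: (measurable_funN mf).
have m0 : measurable_fun A (fun=> 0 : R) by exact: measurable_cst.
have aP : L2_approx (fun x => Num.max (f x) 0).
  apply: L2_approx_nonneg; last by move=> x _; rewrite le_max lexx orbT.
  apply: (L2_le mA _ fL); first exact: measurable_maxr.
  by move=> x _; rewrite ger0_norm ?le_max ?lexx ?orbT// ge_max ler_norm normr_ge0.
have aN : L2_approx (fun x => Num.max (- f x) 0).
  apply: L2_approx_nonneg; last by move=> x _; rewrite le_max lexx orbT.
  apply: (L2_le mA _ fL); first exact: measurable_maxr.
  by move=> x _; rewrite ger0_norm ?le_max ?lexx ?orbT// ge_max -normrN ler_norm normr_ge0.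
apply: (@eq_L2_approx (fun x => Num.max (f x) 0 + (-1) * Num.max (- f x) 0)).
  move=> x _; have [h|h] := leP (f x) 0; have [k|k] := leP (- f x) 0; lra.
by apply: L2_approxD => //; exact: L2_approxZ.
Qed.

(** Testing against approximations of [f] itself makes the left-hand side tend
    to the squared norm of [f]. *)
Theorem L2norm_le_dual f M : 0 <= M -> L2 A f ->
  (forall phi, test_function A phi -> `|L2ip A f phi| <= M * L2norm A phi) ->
  L2norm A f <= M.
Proof.
move=> M0 fL fM; have [//|MN] := leP; exfalso.
set N := L2norm A f in MN.
have N0 : 0 < N by exact: le_lt_trans MN.
(* with this error, [N ^+ 2 <= M * N + (N + M) * e] contradicts [M < N] *)
pose e := N * (N - M) / (2 * (N + M)).
have e0 : 0 < e by rewrite divr_gt0 ?mulr_gt0 ?subr_gt0// ltr_wpDr.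
have [phi tphi hphi] := (test_function_dense fL).2 _ e0.
have pL := test_function_L2 tphi; have dL := L2B mA fL pL.
have sqE : N ^+ 2 = L2ip A f (fun x => f x - phi x) + L2ip A f phi.
  by rewrite [X in X + _]L2ipC L2ipBl// (L2ipC _ phi) subrK L2norm_sqr.
have h1 := le_trans (ler_norm _) (L2ip_le mA fL dL).
have h2 := le_trans (ler_norm _) (fM phi tphi).
have h3 := L2norm_triangle mA fL pL.
rewrite -/N in h1 h3; set a := L2norm A (fun x => f x - phi x) in h1 h3 hphi.
have h4 : L2norm A phi <= N + a by move: h3; rewrite ler_norml; lra.
have h5 : e * (2 * (N + M)) = N * (N - M).
  by rewrite divfK// mulf_neq0// gt_eqF// ltr_wpDr.
have h6 : M * L2norm A phi <= M * (N + a) by rewrite ler_wpM2l.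
have h7 : (N + M) * a <= (N + M) * e by apply: ler_wpM2l; [exact: addr_ge0 (ltW N0) M0|exact: ltW].
have h8 : 0 < N * (N - M) by rewrite mulr_gt0// subr_gt0.
have h9 : N ^+ 2 <= N * a + M * L2norm A phi by rewrite sqE lerD.
have h10 : M * L2norm A phi <= M * (N + a) by [].
lra.
Qed.

End dense.
End test_functions_dense.

(** * Weak derivatives and translations *)

Section translation.
Context {R : realType} {d : nat}.
Local Notation mu := (@lebesgue_rV R d).
Implicit Types (A B U : set 'rV[R]_d) (f g e phi : 'rV[R]_d -> R) (h x : 'rV[R]_d).

Lemma measurable_restrict_rV A f : measurable A -> measurable_fun A f ->
  measurable_fun setT (f \_ A).
Proof. by move=> mA mf; move/(measurable_restrictT _ mA).1 : mf. Qed.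

Lemma Rintegral_shift h f : measurable_fun setT f ->
  \int[mu]_x f (x + h) = \int[mu]_x f x.
Proof.
move=> mf; rewrite /Rintegral; congr fine.
by apply: (@integral_shift _ _ h (EFin \o f)); apply/measurable_EFinP.
Qed.

Lemma L2_shift A B f h : measurable A -> measurable B ->
  (forall x, A x -> B (x + h)) -> L2 B f -> L2 A (fun x => f (x + h)).
Proof.
move=> mA mB AB fL; have [mf fi] := (L2P f mB).1 fL.
apply: (@eq_L2 _ _ _ (fun x => (f \_ B) (x + h))).
  by move=> x /set_mem Ax; rewrite patchE mem_set//; exact: AB.
apply: (@L2S _ _ _ setT) => //; apply/L2P => //; split.
  exact: measurableT_comp (measurable_restrict_rV mB mf) (measurable_addr_rV h).
apply: (@integrable_shift _ _ h (EFin \o (fun x => (f \_ B) x ^+ 2))).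
move/(integrable_mkcond _ mB) : fi; congr (mu.-integrable _ _).
by apply/funext => x /=; rewrite !patchE; case: ifP => // _; rewrite expr0n.
Qed.

Lemma L2norm_setT_patch A f : measurable A -> L2norm A f = L2norm setT (f \_ A).
Proof.
by move=> mA; rewrite /L2norm; congr (fine (Lnorm _ _ _)); apply/funext => x /=; rewrite !patchE in_setT.
Qed.

Lemma L2norm_shift A B f h : measurable A -> measurable B ->
  (forall x, A x -> B (x + h)) -> L2 B f ->
  L2norm A (fun x => f (x + h)) <= L2norm B f.
Proof.
move=> mA mB AB fL; have [mf fi] := (L2P f mB).1 fL.
have mfB := measurable_restrict_rV mB mf.
have LT : L2 setT (fun x => (f \_ B) (x + h)).
  apply: (@L2_shift setT setT (f \_ B)) => //.
  rewrite /L2 (_ : (f \_ B) \_ setT = f \_ B)//.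
  by apply/funext => x; rewrite patchE in_setT.
have -> : L2norm B f = L2norm setT (fun x => (f \_ B) (x + h)).
  rewrite L2norm_setT_patch// !L2normE//; congr Num.sqrt.
  by rewrite /L2ip (@Rintegral_shift h (fun x => (f \_ B) x * (f \_ B) x))//; exact: measurable_funM.
rewrite (@eq_L2norm _ _ A _ (fun x => (f \_ B) (x + h))); first exact: L2norm_subset.
by move=> x /set_mem Ax; rewrite patchE mem_set//; exact: AB.
Qed.

Lemma derive_sum_pderiv phi h x : differentiable phi x ->
  'D_h phi x = \sum_i h ord0 i * pderiv i phi x.
Proof.
move=> dphi; rewrite deriveE// [X in 'd phi x X](row_sum_delta h) linear_sum.
by apply: eq_bigr => i _; rewrite linearZ /pderiv deriveE.
Qed.

Lemma is_derive_line phi h x (t : R) : differentiable phi (x + t *: h) ->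
  is_derive t (1 : R) (fun s : R => phi (x + s *: h)) ('D_h phi (x + t *: h)).
Proof.
move=> dphi; have c := diff_derivable (v := h) dphi.
have E : (fun k : R => k^-1 *: (((fun s : R => phi (x + s *: h)) \o shift t) (k *: 1) - phi (x + t *: h)))
  = (fun k : R => k^-1 *: ((phi \o shift (x + t *: h)) (k *: h) - phi (x + t *: h))).
  by apply/funext => k /=; rewrite [k%:A]mulr1 scalerDl addrCA.
by split; rewrite /derivable /derive E.
Qed.

(** The difference quotients are dominated, because the gradient of a test
    function is bounded. *)
Lemma is_derive_integral_shift A U f phi h (t : R) : measurable A ->
  mu.-integrable A (EFin \o f) -> test_function U phi ->
  is_derive t (1 : R) (fun s : R => \int[mu]_(x in A) (f x * phi (x + s *: h)))
    (\int[mu]_(x in A) (f x * \sum_i h ord0 i * pderiv i phi (x + t *: h))).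
Proof.
move=> mA fi tphi.
have cphi := test_function_continuous tphi.
have dphi x : differentiable phi x by have [s _ _] := tphi; exact: (s [::]).
have [M0 M00 phiM] := test_function_bounded tphi.
have [M M_ge0 dphiM] : exists2 M, 0 <= M & forall x, `|\sum_i h ord0 i * pderiv i phi x| <= M.
  have /choice[C CP] : forall i, exists C, forall x, `|pderiv i phi x| <= C.
    by move=> i; have [C _ ?] := test_function_bounded (test_function_pderiv i tphi); exists C.
  exists (\sum_i `|h ord0 i| * C i).
    by apply: sumr_ge0 => i _; rewrite mulr_ge0//; exact: le_trans (CP i 0).
  move=> x; apply: le_trans (ler_norm_sum _ _ _) _; apply: ler_sum => i _.
  by rewrite normrM ler_wpM2l.
have mf : measurable_fun A f by apply/measurable_EFinP; case/integrableP: fi.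
have Gi c : mu.-integrable A (EFin \o (fun x => c * `|f x|)).
  exact: (integrableZl mA c (integrable_norm fi)).
have ms s : measurable_fun setT (fun x => phi (x + s *: h)).
  exact: measurableT_comp (continuous_measurable_rV cphi) (measurable_addr_rV _).
have int s : mu.-integrable A (EFin \o (fun x => f x * phi (x + s *: h))).
  apply: (le_integrable mA _ _ (Gi M0)).
    apply/measurable_EFinP; apply: measurable_funM => //; exact: measurable_funTS.
  by move=> x _ /=; rewrite lee_fin !normrM normr_id (mulrC `|f x|) ler_wpM2r// (ger0_norm M00).
have der s x : is_derive s (1 : R) (fun s : R => f x * phi (x + s *: h))
    (f x * \sum_i h ord0 i * pderiv i phi (x + s *: h)).
  have := is_deriveZ (f x) (is_derive_line (dphi (x + s *: h))).
  by rewrite derive_sum_pderiv.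
have I : `]t - 1, t + 1[%classic t by rewrite /= in_itv/=; apply/andP; split; lra.
have d1E s x : partial1of2 (fun (s : R) x => f x * phi (x + s *: h)) s x =
   f x * \sum_i h ord0 i * pderiv i phi (x + s *: h).
  by rewrite partial1of2E (@derive_val _ _ _ _ _ _ _ (der s x)).
have G0 x : 0 <= M * `|f x| by rewrite mulr_ge0.
have Gub s x : `]t - 1, t + 1[%classic s -> A x ->
    `|partial1of2 (fun (s : R) x => f x * phi (x + s *: h)) s x| <= M * `|f x|.
  by move=> _ _; rewrite d1E normrM mulrC ler_wpM2r//.
have derf s x : `]t - 1, t + 1[%classic s -> A x ->
   derivable (fun s : R => f x * phi (x + s *: h)) s 1.
  by move=> _ _; have [] := der s x.
split; first exact: (@derivable_under_integral _ _ _ mu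
  (fun (s : R) x => f x * phi (x + s *: h)) A mA t (t - 1) (t + 1) I (fun s _ => int s) derf _ G0 (Gi M) Gub).
rewrite -derive1E (@differentiation_under_integral _ _ _ mu
  (fun (s : R) x => f x * phi (x + s *: h)) A mA t (t - 1) (t + 1) I (fun s _ => int s) derf _ G0 (Gi M) Gub).
by apply: eq_Rintegral => x _; rewrite d1E.
Qed.

End translation.

Section weak_derivatives.
Context {R : realType} {d : nat}.
Local Notation mu := (@lebesgue_rV R d).
Implicit Types (A B U Omega : set 'rV[R]_d) (f g e phi psi : 'rV[R]_d -> R) (h x : 'rV[R]_d).

Lemma Rintegral_support A f : (forall x, ~ A x -> f x = 0) ->
  \int[mu]_(x in A) f x = \int[mu]_x f x.
Proof.
move=> f0; rewrite Rintegral_mkcond; apply: eq_Rintegral => x _; rewrite patchE.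
by case: ifPn => // /negP xA; rewrite f0// => Ax; apply: xA; rewrite inE.
Qed.

Lemma test_function_measurable U phi : test_function U phi -> measurable_fun setT phi.
Proof. by move=> tphi; apply: continuous_measurable_rV; exact: test_function_continuous tphi. Qed.

Lemma sum_delta_rV (i : 'I_d) (F : 'I_d -> R) :
  \sum_j (delta_mx ord0 i : 'rV[R]_d) ord0 j * F j = F i.
Proof.
rewrite (bigD1 i)//= big1 ?addr0 => [|j ji]; last by rewrite mxE (negbTE ji) andbF mul0r.
by rewrite mxE !eqxx mul1r.
Qed.

Lemma lebesgue_bounded A : bounded_set A -> measurable A -> (mu A < +oo)%E.
Proof.
move=> [M [_ AM]] mA.
have r0 : 0 < `|M| + 2 by rewrite ltr_wpDl.
apply: (@le_lt_trans _ _ (mu (ball (0 : 'rV[R]_d) (`|M| + 2)))); last by rewrite lebesgue_rV_ball// ltry.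
apply: le_measure; rewrite ?inE//; first exact: measurable_ball_rV.
move=> x Ax; rewrite -ball_normE/= sub0r normrN.
have := AM (`|M| + 1) _ x Ax.
have := ler_norm M => h1 h2; have : `|x| <= `|M| + 1 by apply: h2; lra.
lra.
Qed.

Section bounded_open.
Variable Omega : set 'rV[R]_d.
Hypotheses (oO : open Omega) (bO : bounded_set Omega).
Let mO : measurable Omega := open_measurable_rV oO.
Let finO : (mu Omega < +oo)%E := lebesgue_bounded bO mO.

Lemma L2_integrable f : L2 Omega f -> mu.-integrable Omega (EFin \o f).
Proof.
move=> fL; have L1 : L2 Omega (fun=> 1 : R).
  by apply: (@L2_bounded _ _ _ _ 1) => // x _; rewrite normr1.
have := L2ip_integrable mO fL L1; congr (mu.-integrable _ _).
by apply/funext => x /=; rewrite mulr1.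
Qed.

Let testL phi : test_function Omega phi -> L2 Omega phi.
Proof. exact: test_function_L2. Qed.

(** By translation invariance, moving [phi] by [t] against [psi] is moving
    [psi] by [- t] against [phi]; differentiating at [t = 0] gives the
    integration by parts. *)
Lemma weak_pderiv_test phi i : test_function Omega phi ->
  is_weak_pderiv Omega i phi (pderiv i phi).
Proof.
move=> tphi psi tpsi.
pose e : 'rV[R]_d := delta_mx ord0 i.
have d1 := is_derive_integral_shift e 0 mO (L2_integrable (testL tphi)) tpsi.
have d2 := is_derive_integral_shift (- e) 0 mO (L2_integrable (testL tpsi)) tphi.
have E : (fun s : R => \int[mu]_(x in Omega) (phi x * psi (x + s *: e))) =
         (fun s : R => \int[mu]_(x in Omega) (psi x * phi (x + s *: - e))).
  apply/funext => s.
  rewrite [LHS]Rintegral_support; last first.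
    by move=> x nO; rewrite (test_function_out tphi nO) mul0r.
  rewrite [RHS]Rintegral_support; last first.
    by move=> x nO; rewrite (test_function_out tpsi nO) mul0r.
  rewrite -(@Rintegral_shift _ _ (s *: e) (fun x => psi x * phi (x + s *: - e))).
    by apply: eq_Rintegral => x _; rewrite scalerN addrK mulrC.
  apply: measurable_funM; first exact: test_function_measurable tpsi.
  exact: measurableT_comp (test_function_measurable tphi) (measurable_addr_rV _).
rewrite E in d1; have := @derive_val _ _ _ _ _ _ _ d1; rewrite (@derive_val _ _ _ _ _ _ _ d2).
under eq_Rintegral do rewrite scale0r addr0.
under [in X in _ = X -> _]eq_Rintegral do rewrite scale0r addr0 sum_delta_rV.
move=> <-; rewrite -mulN1r -RintegralZl//; last first.
  by apply: L2ip_integrable => //; [exact: testL (test_function_pderiv i tphi)|exact: testL tpsi].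
apply: eq_Rintegral => x _; rewrite [RHS]mulrA [RHS]mulrC; congr (_ * _).
rewrite -(sum_delta_rV i (fun j => pderiv j phi x)) mulr_sumr.
by apply: eq_bigr => j _; rewrite /e !mxE mulN1r mulNr.
Qed.

(** The integral over a large ball of a translate of [phi] does not depend on
    the translation, as long as the support stays in the ball. *)
Lemma weak_pderiv_cst (c : R) i : is_weak_pderiv Omega i (fun=> c) (fun=> 0).
Proof.
move=> phi tphi.
under [in RHS]eq_Rintegral do rewrite mul0r.
rewrite Rintegral_cst// mul0r oppr0.
pose e : 'rV[R]_d := delta_mx ord0 i.
have [M [_ OM]] := bO.
have r0 : 0 < `|M| + `|e| + 2 by rewrite ltr_wpDl// addr_ge0.
pose B := ball (0 : 'rV[R]_d) (`|M| + `|e| + 2).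
have mB : measurable B by exact: measurable_ball_rV.
have finB : (mu B < +oo)%E by rewrite /B lebesgue_rV_ball// ltry.
have iB : mu.-integrable B (EFin \o (fun=> c)).
  apply/integrableP; split; first exact/measurable_EFinP.
  rewrite /= (_ : (fun _ => _) = cst (`|c|%:E))// integral_cst//.
  by rewrite lte_mul_pinfty.
have d1 := is_derive_integral_shift e 0 mB iB tphi.
have OB x (s : R) : `|s| < 1 -> Omega x -> B (x + s *: e).
  move=> s1 Ox; rewrite /B -ball_normE /= sub0r normrN.
  have h1 : `|x| <= `|M| + 1 by apply: OM => //; have := ler_norm M; lra.
  have h2 : `|s *: e| <= `|e| by rewrite normrZ ler_piMl// ltW.
  by apply: le_lt_trans (ler_normD _ _) _; lra.
have mcphi : measurable_fun setT (fun x => c * phi x).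
  by apply: measurable_funM => //; exact: test_function_measurable tphi.
have d2 : is_derive (0 : R) (1 : R) (fun s : R => \int[mu]_(x in B) (c * phi (x + s *: e))) 0.
  apply: (@near_eq_is_derive _ _ _ (cst (\int[mu]_x (c * phi x)) : R -> R)).
  near=> s.
  rewrite [RHS]Rintegral_support; last first.
    move=> x nB; rewrite (test_function_out tphi) ?mulr0// => Oxs; apply: nB.
    rewrite -(addrK (s *: e) x) -scaleNr; apply: OB => //; rewrite normrN.
    by near: s; exact: (@nbhs0_lt _ R^o).
  by rewrite /cst (@Rintegral_shift _ _ (s *: e) (fun x => c * phi x)).
have := @derive_val _ _ _ _ _ _ _ d1; rewrite (@derive_val _ _ _ _ _ _ _ d2) => /esym d0; rewrite -[RHS]d0.
under [RHS]eq_Rintegral do rewrite scale0r addr0 sum_delta_rV.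
have cpO : forall x, ~ Omega x -> c * pderiv i phi x = 0.
  by move=> x nO; rewrite (test_function_out (test_function_pderiv i tphi) nO) mulr0.
rewrite [LHS]Rintegral_support// [RHS]Rintegral_support// => x nB; apply: cpO => Ox.
by apply: nB; rewrite -(addr0 x) -(scale0r e); apply: OB => //; rewrite normr0.
Unshelve. all: by end_near. Qed.

End bounded_open.

(** Tested against a test function [phi], the translation difference is
    [F 1 - F 0] for [F t] the integral of [e] against [phi] translated by
    [t h]; the mean value theorem and the definition of weak derivatives bound
    it by the weak gradient of [e]. *)
Lemma L2norm_translation Omega A e (g : 'I_d -> 'rV[R]_d -> R) h :
  open Omega -> bounded_set Omega -> open A ->
  (forall x t, A x -> 0 <= t <= 1 -> Omega (x + t *: h)) ->
  L2 Omega e -> (forall i, L2 Omega (g i)) ->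
  (forall i, is_weak_pderiv Omega i e (g i)) ->
  L2norm A (fun x => e (x + h) - e x) <= \sum_i `|h ord0 i| * L2norm Omega (g i).
Proof.
move=> oO bO oA AO eL gL eg.
have mO := open_measurable_rV oO; have mA := open_measurable_rV oA.
have finO := lebesgue_bounded bO mO.
have AsubO : A `<=` Omega.
  by move=> x Ax; rewrite -(addr0 x) -(scale0r h); apply: AO => //; rewrite lexx ler01.
have AhO x : A x -> Omega (x + h).
  by move=> Ax; rewrite -(scale1r h); apply: AO => //; rewrite lexx ler01.
have finA : (mu A < +oo)%E by apply: le_lt_trans finO; apply: le_measure; rewrite ?inE.
have ehL : L2 A (fun x => e (x + h)) by exact: (L2_shift mA mO AhO eL).
have eLA : L2 A e by exact: L2S mA mO AsubO eL.
apply: (L2norm_le_dual oA finA); first by apply: sumr_ge0 => i _; rewrite mulr_ge0 ?L2norm_ge0.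
  exact: L2B.
move=> phi tphi.
have pLA : L2 A phi by exact: test_function_L2 oA finA _ _ tphi.
pose F (s : R) := \int[mu]_(x in Omega) (e x * phi (x + s *: - h)).
pose DF (t : R) := \int[mu]_(x in Omega) (e x * \sum_i (- h) ord0 i * pderiv i phi (x + t *: - h)).
have dF t : is_derive t (1 : R) F (DF t).
  by apply: is_derive_integral_shift tphi => //; exact: L2_integrable.
have cF : {within `[0, 1], continuous F}.
  by apply: derivable_within_continuous => s _; have [] := dF s.
have [t] := MVT ltr01 (fun t _ => dF t) cF.
rewrite in_itv/= => /andP[t0 t1]; rewrite subr0 mulr1 => FE.
have tphit : test_function Omega (fun x => phi (x + t *: - h)).
  apply: test_function_shift tphi _ => x Ax; rewrite scalerN opprK; apply: AO => //.
  by rewrite !ltW.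
have ptL := test_function_L2 oO finO tphit.
have DFE : DF t = \sum_i h ord0 i * L2ip Omega (g i) (fun x => phi (x + t *: - h)).
  rewrite /DF -[LHS]/(L2ip Omega e (fun x => \sum_i (- h) ord0 i * pderiv i phi (x + t *: - h))).
  have dpL i : L2 Omega (fun x => pderiv i phi (x + t *: - h)).
    by rewrite -pderiv_shift; apply: (test_function_L2 oO finO); exact: test_function_pderiv tphit.
  rewrite L2ip_sumr// => [|i]; last exact: L2Z.
  apply: eq_bigr => i _; rewrite L2ipC L2ipZl// L2ipC mxE mulNr -mulrN; congr (_ * _).
  by rewrite -pderiv_shift; rewrite /L2ip eg// opprK.
have -> : L2ip A (fun x => e (x + h) - e x) phi = F 1 - F 0.
  rewrite L2ipBl//; congr (_ - _); last first.
    rewrite /F /L2ip [LHS]Rintegral_mkcond [RHS]Rintegral_mkcond; apply: eq_Rintegral => x _.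
    rewrite !patchE scale0r addr0; case: ifPn => [/set_mem/AsubO Ox|/negP nA].
      by rewrite mem_set.
    by case: ifPn => // _; rewrite (test_function_out tphi) ?mulr0// => Ax; apply: nA; rewrite inE.
  rewrite /F /L2ip; set eO := e \_ Omega.
  have meO : measurable_fun setT eO by apply: measurable_restrict_rV => //; exact: L2_measurable.
  transitivity (\int[mu]_x (eO x * phi (x - h))); last first.
    rewrite [RHS]Rintegral_mkcond; apply: eq_Rintegral => x _; rewrite scale1r /eO !patchE.
    by case: ifPn => // _; rewrite mul0r.
  rewrite -(@Rintegral_shift _ _ h (fun x => eO x * phi (x - h))); last first.
    apply: measurable_funM => //.
    exact: measurableT_comp (test_function_measurable tphi) (measurable_addr_rV _).
  rewrite [LHS]Rintegral_mkcond; apply: eq_Rintegral => x _.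
  rewrite addrK patchE; case: ifPn => [/set_mem/AhO Ox|/negP nA].
    by rewrite /eO patchE mem_set.
  by rewrite (test_function_out tphi) ?mulr0// => Ax; apply: nA; rewrite inE.
rewrite FE DFE mulr_suml; apply: le_trans (ler_norm_sum _ _ _) _; apply: ler_sum => i _.
rewrite normrM -mulrA ler_wpM2l//; apply: le_trans (L2ip_le mO (gL i) ptL) _.
rewrite ler_wpM2l ?L2norm_ge0//.
have pT : phi \_ A = phi \_ setT.
  apply/funext => x; rewrite !patchE in_setT; case: ifPn => // /negP nA.
  by rewrite (test_function_out tphi)// => Ax; apply: nA; rewrite inE.
have -> : L2norm A phi = L2norm setT phi by rewrite /L2norm pT.
apply: L2norm_shift => //.
by move: pLA; rewrite /L2 pT.
Qed.

End weak_derivatives.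

(** * The Poincare inequality on a ball *)

Section poincare_ball.
Context {R : realType} {d : nat}.
Local Notation mu := (@lebesgue_rV R d).
Implicit Types (A B U Omega : set 'rV[R]_d) (f e : 'rV[R]_d -> R) (h x : 'rV[R]_d)
  (g : 'I_d -> 'rV[R]_d -> R).

Definition weak_gradient Omega e g :=
  [/\ L2 Omega e, forall i, L2 Omega (g i) & forall i, is_weak_pderiv Omega i e (g i)].

(** The [l^1] combination of the component norms is what the triangle
    inequality yields; it is at most [d] times the H^1 seminorm. *)
Definition gradnorm Omega g : R := \sum_i L2norm Omega (g i).

Lemma gradnorm_ge0 Omega g : 0 <= gradnorm Omega g.
Proof. by apply: sumr_ge0 => i _; exact: L2norm_ge0. Qed.

Lemma L2norm_translation_le Omega A e g h :
  open Omega -> bounded_set Omega -> open A ->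
  (forall x t, A x -> 0 <= t <= 1 -> Omega (x + t *: h)) ->
  weak_gradient Omega e g ->
  L2norm A (fun x => e (x + h) - e x) <= `|h| * gradnorm Omega g.
Proof.
move=> oO bO oA AO [eL gL eg].
apply: le_trans (L2norm_translation oO bO oA AO eL gL eg) _.
rewrite /gradnorm mulr_sumr; apply: ler_sum => i _.
by rewrite ler_wpM2r ?L2norm_ge0// ler_coord_norm.
Qed.

(** Twice the average is used in the conclusion, since then only the case of a
    zero average needs an argument on null sets. *)
Lemma ge0_integral_exists_le A (f : 'rV[R]_d -> \bar R) (a : R) :
  measurable A -> (0 < mu A)%E -> (mu A < +oo)%E ->
  measurable_fun A f -> (forall x, 0 <= f x)%E -> 0 <= a ->
  (\int[mu]_(x in A) f x <= a%:E * mu A)%E -> exists2 x, A x & (f x <= (a *+ 2)%:E)%E.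
Proof.
move=> mA A0 Aoo mf f0 a0 fa; apply: contrapT => /forall2NP h.
have {}h x : A x -> ((a *+ 2)%:E < f x)%E.
  by move=> Ax; rewrite ltNge; apply/negP => fx; have [] := h x.
have [a_eq0|a_neq0] := eqVneq a 0.
  have i0 : (\int[mu]_(x in A) `|f x| = 0)%E.
    apply/eqP; rewrite eq_le; apply/andP; split; last exact: integral_ge0.
    under eq_integral do rewrite gee0_abs//.
    by apply: le_trans fa _; rewrite a_eq0 mul0e.
  have [N [mN N0 AN]] := (ae_eq_integral_abs mu mA mf).1 i0.
  suff : (mu A <= mu N)%E by rewrite N0 leNgt A0.
  apply: le_measure; rewrite ?inE// => x Ax; apply: AN => /= /(_ Ax) fx0.
  by have := h x Ax; rewrite fx0 a_eq0 mul0rn ltxx.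
have {}a0 : 0 < a by rewrite lt_neqAle eq_sym a_neq0.
have : ((a *+ 2)%:E * mu A <= \int[mu]_(x in A) f x)%E.
  rewrite -integral_cst//; apply: ge0_le_integral => //.
  - by move=> x _; rewrite lee_fin mulrn_wge0// ltW.
  - by move=> x Ax; rewrite ltW// h.
move=> /le_trans/(_ fa); apply/negP; rewrite -ltNge lte_pmul2r//.
  by rewrite lte_fin mulr2n ltrDl.
by rewrite ge0_fin_numE// ltW.
Qed.

Lemma ball_convex (x0 : 'rV[R]_d) r x h t : ball x0 r x -> ball x0 r (x + h) ->
  0 <= t <= 1 -> ball x0 r (x + t *: h).
Proof.
rewrite -!ball_normE /= => xr xhr /andP[t0 t1].
have -> : x0 - (x + t *: h) = (1 - t) *: (x0 - x) + t *: (x0 - (x + h)).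
  by rewrite !scalerBr scalerDr !scalerBl !scale1r; apply/rowP => i; rewrite !mxE; ring.
apply: le_lt_trans (ler_normD _ _) _; rewrite !normrZ (ger0_norm t0) ger0_norm ?subr_ge0//.
have [t_eq0|t_neq0] := eqVneq t 0; first by rewrite t_eq0; lra.
have {}t0 : 0 < t by rewrite lt_neqAle eq_sym t_neq0.
have h1 : (1 - t) * `|x0 - x| <= (1 - t) * r by rewrite ler_wpM2l ?subr_ge0// ltW.
have h2 : t * `|x0 - (x + h)| < t * r by rewrite ltr_pM2l.
lra.
Qed.

Section double_integral.
Variables (Omega : set 'rV[R]_d) (x0 : 'rV[R]_d) (r : R).
Hypotheses (oO : open Omega) (bO : bounded_set Omega) (r0 : 0 < r).
Local Notation B := (ball x0 r : set 'rV[R]_d).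
Hypothesis BO : B `<=` Omega.
Variables (e : 'rV[R]_d -> R) (g : 'I_d -> 'rV[R]_d -> R).
Hypothesis eg : weak_gradient Omega e g.

Let mO : measurable Omega := open_measurable_rV oO.
Let mB : measurable B := measurable_ball_rV x0 r0.
Let eL : L2 Omega e. Proof. by case: eg. Qed.
Let eB := e \_ B.
Let psi (z : 'rV[R]_d * 'rV[R]_d) : \bar R :=
  (\1_B z.1 * \1_B z.2 * (eB z.1 - eB z.2) ^+ 2)%:E.

Let psi_ge0 z : (0 <= psi z)%E.
Proof. by rewrite lee_fin mulr_ge0 ?sqr_ge0// mulr_ge0. Qed.

Let meB : measurable_fun setT eB.
Proof.
apply: measurable_restrict_rV => //; apply: measurable_funS mO BO _.
exact: L2_measurable.
Qed.

Let mpsi : measurable_fun setT psi.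
Proof.
have m1 : measurable_fun setT (\1_B : 'rV[R]_d -> R) by exact: measurable_indic.
apply/measurable_EFinP; apply: measurable_funM.
  apply: measurable_funM; first exact: (measurableT_comp m1 measurable_fst).
  exact: (measurableT_comp m1 measurable_snd).
apply: (@measurable_funX _ _ _ _ (fun z : 'rV[R]_d * 'rV[R]_d => eB z.1 - eB z.2)).
apply: measurable_funB.
- exact: (measurableT_comp meB).
- exact: (measurableT_comp meB).
Qed.

Let shear (z : 'rV[R]_d * 'rV[R]_d) : 'rV[R]_d * 'rV[R]_d := (z.1, z.2 + z.1).

Let mshear : measurable_fun setT shear.
Proof.
apply: measurable_fun_pair => //; apply: measurable_fun_rV => i.
under eq_fun do rewrite mxE.
apply: measurable_funD; first exact: (measurableT_comp (measurable_coord_rV i)).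
exact: (measurableT_comp (measurable_coord_rV i)).
Qed.

(** Substituting [y = x + h] turns the average of squared differences over
    pairs of points into an average over translations. *)
Let double_integral_le :
  (\int[mu]_y \int[mu]_x psi (x, y) <=
   (((r *+ 2) * gradnorm Omega g) ^+ 2 * (r *+ 2 *+ 2) ^+ d)%:E)%E.
Proof.
rewrite -(@fubini_tonelli _ _ _ _ _ mu mu psi mpsi psi_ge0).
have -> : (\int[mu]_x \int[mu]_y psi (x, y) = \int[mu]_x \int[mu]_h psi (shear (x, h)))%E.
  apply: eq_integral => x _; rewrite /shear /=.
  by rewrite (@integral_shift _ _ x (fun y => psi (x, y)))//; exact: measurableT_comp mpsi _.
have mps : measurable_fun setT (psi \o shear) by exact: measurableT_comp mpsi mshear.
rewrite (@fubini_tonelli _ _ _ _ _ mu mu _ mps (fun z => psi_ge0 (shear z))).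
have r20 : 0 < r *+ 2 by rewrite mulrn_wgt0.
pose B2 : set 'rV[R]_d := ball (0 : 'rV[R]_d) (r *+ 2).
have mB2 : measurable B2 by exact: measurable_ball_rV.
set c := ((r *+ 2) * gradnorm Omega g) ^+ 2.
have le1 h : (\int[mu]_x psi (shear (x, h)) <= (cst c%:E \_ B2) h)%E.
  pose A : set 'rV[R]_d := B `&` [set x | B (x + h)].
  have oA : open A.
    apply: openI; first exact: ball_open.
    apply: open_comp; last exact: ball_open.
    by move=> x _; apply: continuousD => //; exact: cst_continuous.
  have mA := open_measurable_rV oA.
  have AB : A `<=` B by move=> x [].
  have AhB x : A x -> B (x + h) by move=> [].
  have -> : (\int[mu]_x psi (shear (x, h)) = \int[mu]_(x in A) ((e (x + h) - e x) ^+ 2)%:E)%E.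
    rewrite [RHS]integral_mkcond; apply: eq_integral => x _; rewrite /psi /shear /= patchE.
    rewrite (addrC h) /eB !patchE !indicE /A in_setI.
    have [xB|] := boolP (x \in B); last by rewrite !mul0r.
    rewrite (_ : (x \in [set x | B (x + h)]) = (x + h \in B)); last first.
      by apply/idP/idP; rewrite !inE.
    have [xhB|] := boolP (x + h \in B) => /=; last by rewrite mulr0 mul0r.
    by rewrite !mul1r -sqrrN opprB.
  have dL : L2 A (fun x => e (x + h) - e x).
    apply: L2B => //; last exact: L2S mA mO (subset_trans AB BO) eL.
    by apply: (L2_shift mA mO _ eL) => x /AhB/BO.
  rewrite integral_sqr_L2norm// patchE.
  case: ifPn => [/set_mem hB2|/negP nB2].
    rewrite lee_fin lerXn2r ?nnegrE ?L2norm_ge0//.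
      by rewrite mulr_ge0 ?gradnorm_ge0// ltW.
    apply: (@le_trans _ _ (`|h| * gradnorm Omega g)).
      apply: L2norm_translation_le => // x t Ax t01; apply: BO.
      by apply: ball_convex => //; [exact: AB|exact: AhB].
    rewrite ler_wpM2r ?gradnorm_ge0//.
    by move: hB2; rewrite /B2 -ball_normE /= sub0r normrN => /ltW.
  rewrite (_ : A = set0); first by rewrite L2normE// /L2ip Rintegral_set0 sqrtr0 expr0n.
  rewrite -subset0 => x [xB xhB]; apply: nB2; rewrite inE /B2 -ball_normE /= sub0r normrN.
  move: xB xhB; rewrite -!ball_normE /= => h1 h2.
  have -> : h = (x0 - x) - (x0 - (x + h)) by apply/rowP => i; rewrite !mxE; ring.
  by apply: le_lt_trans (ler_normB _ _) _; rewrite mulr2n ltrD.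
apply: (@le_trans _ _ (\int[mu]_h (cst c%:E \_ B2) h)%E).
  apply: ge0_le_integral => //.
  - by move=> h _; apply: integral_ge0 => x _; exact: psi_ge0.
  - exact: (@measurable_fun_fubini_tonelli_G _ _ _ _ _ mu _ mps (fun z => psi_ge0 (shear z))).
  - by move/(measurable_restrictT _ mB2).1 : (@measurable_cst _ _ 'rV[R]_d _ B2 c%:E).
  - by move=> h _; exact: le1.
have muB2 : mu B2 = ((r *+ 2 *+ 2) ^+ d)%:E by exact: lebesgue_rV_ball.
by rewrite -integral_mkcond integral_cst// (EFinM c) -muB2.
Qed.

(** The constant is a value [e y] for which the integral of the squared
    differences [e x - e y] is not much above its average. *)
Lemma poincare_ball_const : exists c : R,
  L2norm B (fun x => e x - c) <=
  (r *+ 2) * Num.sqrt (2 ^+ d *+ 2) * gradnorm Omega g.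
Proof.
pose I y := (\int[mu]_x psi (x, y))%E.
have mI : measurable_fun setT I.
  exact: (@measurable_fun_fubini_tonelli_G _ _ _ _ _ mu _ mpsi psi_ge0).
have I0 y : (0 <= I y)%E by apply: integral_ge0.
have r20 : 0 < r *+ 2 by rewrite mulrn_wgt0.
pose a := ((r *+ 2) * gradnorm Omega g) ^+ 2 * 2 ^+ d.
have a0 : 0 <= a by rewrite mulr_ge0 ?sqr_ge0// exprn_ge0.
have muB : mu B = ((r *+ 2) ^+ d)%:E by exact: lebesgue_rV_ball.
have [||||||y By] := @ge0_integral_exists_le B I a mB.
- by rewrite muB lte_fin exprn_gt0.
- by rewrite muB ltry.
- exact: measurable_funTS.
- exact: I0.
- exact: a0.
- apply: (@le_trans _ _ (\int[mu]_y I y)%E).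
    by apply: ge0_subset_integral.
  apply: le_trans double_integral_le _; rewrite muB -EFinM lee_fin.
  have -> : (r *+ 2 *+ 2) ^+ d = 2 ^+ d * (r *+ 2) ^+ d by rewrite -exprMn mulr_natl.
  by rewrite mulrA.
move=> Iy; exists (e y).
have cL (c : R) : L2 B (fun=> c).
  by apply: (@L2_bounded _ _ _ _ `|c|) => //; rewrite muB ltry.
have dL : L2 B (fun x => e x - e y) by apply: L2B => //; exact: L2S eL.
have IyE : I y = (L2norm B (fun x => e x - e y) ^+ 2)%:E.
  rewrite -integral_sqr_L2norm// [RHS]integral_mkcond; apply: eq_integral => x _.
  rewrite /psi /eB /= !patchE !indicE (mem_set By) mulr1.
  by case: (x \in _); rewrite ?mul1r// mul0r.
have G0 := gradnorm_ge0 Omega g.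
rewrite -(@ler_pXn2r _ 2) ?nnegrE ?L2norm_ge0//; last first.
  by rewrite !mulr_ge0 ?sqrtr_ge0// ltW.
move: Iy; rewrite IyE lee_fin => /le_trans; apply.
rewrite /a !exprMn sqr_sqrtr; last by rewrite mulrn_wge0// exprn_ge0.
by rewrite le_eqVlt; apply/orP; left; apply/eqP; ring.
Qed.

End double_integral.
End poincare_ball.

(** * The Poincare-Wirtinger inequality *)

Section poincare_wirtinger.
Context {R : realType} {d : nat}.
Local Notation mu := (@lebesgue_rV R d).
Implicit Types (A B U : set 'rV[R]_d) (f e : 'rV[R]_d -> R) (h x : 'rV[R]_d)
  (g : 'I_d -> 'rV[R]_d -> R).

Section reach.
Variables (Omega B0 : set 'rV[R]_d).
Hypotheses (oO : open Omega) (bO : bounded_set Omega).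
Let mO : measurable Omega := open_measurable_rV oO.

(** The bound is uniform in [c], so that one constant, chosen for [B0], serves
    all the sets reached from it. *)
Definition reach A := exists2 K : R, 0 <= K &
  forall e g c, weak_gradient Omega e g ->
  L2norm A (fun x => e x - c) <= K * (gradnorm Omega g + L2norm B0 (fun x => e x - c)).

Let finO : (mu Omega < +oo)%E := lebesgue_bounded bO mO.

Let L2sub A e c : measurable A -> A `<=` Omega -> L2 Omega e -> L2 A (fun x => e x - c).
Proof.
move=> mA AO eL; apply: (L2S mA mO AO); apply: L2B => //.
exact: L2_cst.
Qed.

Lemma reach_subset A B : measurable A -> measurable B -> B `<=` Omega -> A `<=` B ->
  reach B -> reach A.
Proof.
move=> mA mB BO AB [K K0 KP]; exists K => // e g c eg.
apply: le_trans (KP e g c eg); apply: L2norm_subset => //.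
by apply: L2sub => //; case: eg.
Qed.

Lemma reach0 : reach set0.
Proof.
exists 0 => // e g c _; rewrite mul0r L2normE//.
by rewrite /L2ip Rintegral_set0 sqrtr0.
Qed.

Lemma reach_self : reach B0.
Proof.
by exists 1 => // e g c _; rewrite mul1r lerDr gradnorm_ge0.
Qed.

Lemma reachU A B : measurable A -> measurable B -> A `<=` Omega -> B `<=` Omega ->
  reach A -> reach B -> reach (A `|` B).
Proof.
move=> mA mB AO BO [K K0 KP] [L L0 LP]; exists (K + L); first exact: addr_ge0.
move=> e g c eg; rewrite mulrDl.
apply: le_trans (lerD (KP e g c eg) (LP e g c eg)); apply: L2norm_setU => //.
apply: L2sub; [exact: measurableU|by rewrite subUset|by case: eg].
Qed.

(** On [A], [e - c] differs from its translate by at most [L2norm_translation],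
    and the norm of the translate over [A] is that of [e - c] over [A + h],
    a subset of [B]. *)
Lemma reach_translate A B h : open A -> measurable B -> B `<=` Omega ->
  (forall x t, A x -> 0 <= t <= 1 -> Omega (x + t *: h)) ->
  (forall x, A x -> B (x + h)) -> reach B -> reach A.
Proof.
move=> oA mB BO AO AB [K K0 KP]; have mA := open_measurable_rV oA.
have AsubO : A `<=` Omega.
  by move=> x Ax; rewrite -(addr0 x) -(scale0r h); apply: AO => //; rewrite lexx ler01.
exists (K + `|h|); first exact: addr_ge0.
move=> e g c eg; have [eL gL _] := eg.
have tr := L2norm_translation_le oO bO oA AO eg.
have bL : L2 B (fun x => e x - c) by exact: L2sub.
have sh := L2norm_shift mA mB AB bL.
have shL : L2 A (fun x => e (x + h) - c) by exact: (L2_shift mA mB AB bL).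
have AO1 x : A x -> Omega (x + h) by move=> /AB/BO.
have dL : L2 A (fun x => e x - e (x + h)).
  by apply: L2B => //; [exact: L2S AsubO eL|exact: L2_shift AO1 eL].
rewrite (@eq_L2norm _ _ _ _ (fun x => (e (x + h) - c) + (e x - e (x + h)))); last first.
  by move=> x _; ring.
apply: le_trans (L2normD mA shL dL) _; rewrite [X in _ + X]L2normBC//.
have := KP e g c eg; have := gradnorm_ge0 Omega g; have := L2norm_ge0 B0 (fun x => e x - c).
have := normr_ge0 h; nra.
Qed.

(** The centers of reached balls form an open subset of [Omega]. It is closed
    in [Omega]: a small ball around a limit point can be translated into a
    reached ball around a nearby point. *)
Lemma reach_interior x0 rho : connected Omega -> 0 < rho -> B0 = ball x0 rho -> B0 `<=` Omega ->
  forall x, Omega x -> exists r, [/\ 0 < r, ball x r `<=` Omega & reach (ball x r)].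
Proof.
move=> cO r00 B0E B0O.
pose T := [set x | exists r, [/\ 0 < r, ball x r `<=` Omega & reach (ball x r)]].
have TO : T `<=` Omega by move=> x [r [r0 rO _]]; apply: rO; exact: ballxx.
suff OT : Omega = T by move=> x; rewrite {1}OT.
apply/esym; apply: cO.
- by exists x0, rho; rewrite -B0E; split => //; exact: reach_self.
- exists T; last by rewrite setIidr.
  rewrite openE => x [r [r0 rO rR]]; apply/nbhs_ballP.
  have r20 : 0 < r / 2 by rewrite divr_gt0.
  exists (r / 2) => //= y xy.
  have sub : ball y (r / 2) `<=` ball x r.
    by move=> z yz; rewrite (splitr r); exact: ball_triangle yz.
  exists (r / 2); split=> //; first exact: subset_trans rO.
  by apply: reach_subset rR => //; exact: measurable_ball_rV.
exists (closure T); first exact: closed_closure.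
apply/seteqP; split => [x Tx|x [Ox cTx]]; first by split; [exact: TO|exact: subset_closure].
have /nbhs_ballP[r /= r0 rO] : nbhs x Omega by exact: open_nbhs_nbhs.
have r20 : 0 < r / 2 by rewrite divr_gt0.
have [y [[s [s0 sO sR]] xy]] := cTx _ (nbhsx_ballx x (r / 2) r20).
pose q := Num.min s (r / 2).
have q0 : 0 < q by rewrite lt_min s0.
have qs : q <= s by rewrite ge_min lexx.
have qr : q <= r / 2 by rewrite ge_min lexx orbT.
exists q; split=> //.
  by apply: subset_trans rO; apply: le_ball; lra.
apply: (@reach_translate _ (ball y s) (y - x)) sR => //.
- exact: ball_open.
- exact: measurable_ball_rV.
- move=> z t; rewrite -ball_normE /= => xz /andP[t0 t1]; apply: rO; rewrite -ball_normE /=.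
  move: xy; rewrite -ball_normE /= => xy.
  have -> : x - (z + t *: (y - x)) = (x - z) + t *: (x - y).
    by apply/rowP => i; rewrite !mxE; ring.
  apply: le_lt_trans (ler_normD _ _) _; rewrite normrZ ger0_norm//.
  have : t * `|x - y| <= `|x - y| by rewrite ler_piMl.
  lra.
- move=> z; rewrite -!ball_normE /= => xz.
  have -> : y - (z + (y - x)) = x - z by apply/rowP => i; rewrite !mxE; ring.
  exact: lt_le_trans qs.
Qed.

(** Near a boundary point the domain is an epigraph, so it is stable under
    small translations along the axis of the epigraph, and such a translation
    moves a neighborhood of the point into the interior. *)
Lemma reach_boundary : lipschitz_boundary Omega ->
  (forall x, Omega x -> exists r, [/\ 0 < r, ball x r `<=` Omega & reach (ball x r)]) ->
  forall x0, closure Omega x0 -> ~ Omega x0 ->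
  exists2 r, 0 < r & reach (Omega `&` ball x0 r).
Proof.
move=> lip inside x0 cx0 nx0.
have [|Q [k [gamma [QQ [M [_ /(_ (`|M| + 1)) gammaM]]]]]] := lip x0.
  by split=> // /interior_subset.
have {}gammaM : forall y z, `|gamma y - gamma z| <= (`|M| + 1) * `|y - z|.
  by move=> y z; apply: (gammaM _ (y, z)) => //; have := ler_norm M; lra.
set L := `|M| + 1 in gammaM; have L0 : 0 <= L by rewrite addr_ge0.
move=> /nbhs_ballP[/= dl dl0 loc].
have QtQ : Q^T *m Q = 1%:M by exact: mulmx1C.
(* the direction of the axis of the epigraph *)
pose n : 'rV[R]_d := delta_mx ord0 k *m Q^T.
have nQ : n *m Q = delta_mx ord0 k by rewrite -mulmxA QtQ mulmx1.
have kQ x t : ((x + t *: n) *m Q) ord0 k = (x *m Q) ord0 k + t.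
  by rewrite mulmxDl -scalemxAl nQ !mxE !eqxx mulr1.
have k'Q x t : col' k ((x + t *: n) *m Q) = col' k (x *m Q).
  apply/rowP => j; rewrite mulmxDl -scalemxAl nQ !mxE eqxx /=.
  by rewrite eq_sym (negbTE (neq_lift k j)) mulr0 addr0.
pose q := \sum_i \sum_j `|Q i j|.
have q0 : 0 <= q by apply: sumr_ge0 => i _; apply: sumr_ge0.
have Qq x y j : `|(x *m Q) ord0 j - (y *m Q) ord0 j| <= q * `|x - y|.
  rewrite !mxE -sumrB; apply: le_trans (ler_norm_sum _ _ _) _.
  rewrite mulr_suml; apply: ler_sum => i _; rewrite -mulrBl normrM mulrC.
  apply: ler_pM => //; last by have := ler_coord_norm (x - y) i; rewrite !mxE.
  by rewrite (bigD1 j)//= lerDl sumr_ge0.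
have Qq' x y : `|col' k (x *m Q) - col' k (y *m Q)| <= q * `|x - y|.
  apply: norm_rV_le => [|j]; first exact: mulr_ge0.
  by have := Qq x y (lift k j); rewrite !mxE.
(* [x0] is a limit of points above the graph *)
have g0 : gamma (col' k (x0 *m Q)) <= (x0 *m Q) ord0 k.
  rewrite leNgt; apply/negP => lt.
  pose a := gamma (col' k (x0 *m Q)) - (x0 *m Q) ord0 k; have a0 : 0 < a by rewrite subr_gt0.
  have s0 : 0 < a / ((L + 1) * q + 1) by rewrite divr_gt0// ltr_wpDl// mulr_ge0// addr_ge0.
  pose s := Num.min dl (a / ((L + 1) * q + 1)).
  have sp : 0 < s by rewrite lt_min dl0.
  have [y [Oy x0y]] := cx0 _ (nbhsx_ballx x0 s sp).
  have sdl : s <= dl by rewrite ge_min lexx.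
  have sa : s * ((L + 1) * q + 1) <= a.
    by rewrite -ler_pdivlMr ?ge_min ?lexx ?orbT// ltr_wpDl// mulr_ge0// addr_ge0.
  have [/(_ Oy) gy _] := loc y (le_ball sdl x0y).
  have h1 := le_trans (gammaM (col' k (x0 *m Q)) (col' k (y *m Q))) (ler_wpM2l L0 (Qq' x0 y)).
  have h2 := Qq x0 y k.
  move: x0y; rewrite -ball_normE /= => x0y.
  have h3 := le_trans (ler_norm _) h1.
  have h4 : (y *m Q) ord0 k - (x0 *m Q) ord0 k <= q * `|x0 - y|.
    by apply: le_trans h2; rewrite distrC ler_norm.
  have h5 : (L * q + q) * `|x0 - y| <= (L * q + q) * s.
    by apply: ler_wpM2l; [rewrite addr_ge0// mulr_ge0|exact: ltW].
  have : a <= (L * q + q) * `|x0 - y| by rewrite /a; lra.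
  lra.
have n0 : 0 < `|n| + 1 by rewrite ltr_wpDl.
pose tau := dl / 2 / (`|n| + 1).
have tau0 : 0 < tau by rewrite !divr_gt0.
have taun : tau * `|n| < dl / 2.
  rewrite -[ltRHS](divfK (lt0r_neq0 n0)) -/tau ltr_pM2l// ltrDl//.
have Ox1 : Omega (x0 + tau *: n).
  apply: (loc _ _).2.
    rewrite -ball_normE /= opprD addrA subrr sub0r normrN normrZ gtr0_norm//; lra.
  by rewrite k'Q kQ; lra.
have [rho [rho0 rhoO rhoR]] := inside _ Ox1.
pose r := Num.min rho (dl / 2).
have r0 : 0 < r by rewrite lt_min rho0 divr_gt0.
have r_rho : r <= rho by rewrite ge_min lexx.
have r_dl : r <= dl / 2 by rewrite ge_min lexx orbT.
exists r => //.
apply: (@reach_translate _ (ball (x0 + tau *: n) rho) (tau *: n)) rhoR => //.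
- exact: openI oO (ball_open _ _).
- exact: measurable_ball_rV.
- move=> x t [Ox]; rewrite -ball_normE /= => x0x /andP[t0 t1].
  have tt : 0 <= t * tau <= tau by rewrite mulr_ge0 ?(ltW tau0)//= ler_piMl// ltW.
  have /andP[tt0 tt1] := tt.
  rewrite scalerA; apply: (loc _ _).2.
    rewrite -ball_normE /= opprD addrA; apply: le_lt_trans (ler_normB _ _) _.
    rewrite normrZ ger0_norm//.
    have : t * tau * `|n| <= tau * `|n| by rewrite ler_wpM2r.
    lra.
  have [/(_ Ox) gx _] : Omega x <-> gamma (col' k (x *m Q)) < (x *m Q) ord0 k.
    by apply: loc; rewrite -ball_normE /=; lra.
  by rewrite k'Q kQ; lra.
- move=> x [_]; rewrite -!ball_normE /= => x0x.
  by rewrite opprD addrACA subrr addr0; apply: lt_le_trans r_rho.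
Qed.

End reach.

Theorem poincare_wirtinger Omega : bounded_lipschitz_domain Omega ->
  exists2 K : R, 0 <= K & forall e g, weak_gradient Omega e g ->
  exists c : R, L2norm Omega (fun x => e x - c) <= K * gradnorm Omega g.
Proof.
move=> [[x0 Ox0] oO cO bO lip].
have mO := open_measurable_rV oO.
have /nbhs_ballP[r0 /= r00 r0O] : nbhs x0 Omega by exact: open_nbhs_nbhs.
set B0 : set 'rV[R]_d := ball x0 r0 in r0O.
have inside := reach_interior oO bO cO r00 (erefl B0) r0O.
have local x : closure Omega x -> exists r, 0 < r /\ reach Omega B0 (Omega `&` ball x r).
  move=> cOx; have [Ox|nOx] := pselect (Omega x); last first.
    by have [r ? ?] := reach_boundary oO bO lip inside cOx nOx; exists r.
  have [r [rp rO rR]] := inside x Ox; exists r; split => //.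
  apply: (reach_subset oO bO _ _ rO _ rR) => //; last exact: measurable_ball_rV.
  by apply: measurableI => //; exact: measurable_ball_rV.
have /choice[r rP] : forall x, exists r, closure Omega x -> 0 < r /\ reach Omega B0 (Omega `&` ball x r).
  move=> x; have [/local[r ?]|nx] := pselect (closure Omega x); first by exists r.
  by exists 0.
have := bounded_compact_closure bO; rewrite compact_cover.
move=> /(_ 'rV[R]_d (closure Omega) (fun x => ball x (r x))) [].
- by move=> x _; exact: ball_open.
- by move=> x cx; exists x => //; apply: ballxx; have [] := rP x cx.
move=> D DO cov.
have reachD : reach Omega B0 (\big[setU/set0]_(x <- enum_fset D) (Omega `&` ball x (r x))) /\
   measurable (\big[setU/set0]_(x <- enum_fset D) (Omega `&` ball x (r x))) /\
   \big[setU/set0]_(x <- enum_fset D) (Omega `&` ball x (r x)) `<=` Omega.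
  have : {in enum_fset D, forall x, closure Omega x}.
    by move=> x xD; have := DO x xD; rewrite inE.
  elim: (enum_fset D) => [|x s IH] sO.
    by rewrite big_nil; split; [exact: reach0|split => //; exact: sub0set].
  have [|sR [sm sO']] := IH; first by move=> y ys; apply: sO; rewrite in_cons ys orbT.
  have [rx xR] := rP x (sO x (mem_head _ _)).
  have mx : measurable (Omega `&` ball x (r x)).
    by apply: measurableI => //; exact: measurable_ball_rV.
  rewrite big_cons; split; last split.
  - by apply: reachU => //; exact: subIsetl.
  - exact: measurableU.
  - by rewrite subUset; split => //; exact: subIsetl.
have [[K K0 KP] [mD DsubO]] := reachD.
pose K1 := (r0 *+ 2) * Num.sqrt (2 ^+ d *+ 2).
have K10 : 0 <= K1 by rewrite mulr_ge0 ?sqrtr_ge0// mulrn_wge0// ltW.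
exists (K * (1 + K1)); first by rewrite mulr_ge0// addr_ge0.
move=> e g eg; have [c hc] := poincare_ball_const oO bO r00 r0O eg.
exists c.
have OE : Omega = \big[setU/set0]_(x <- enum_fset D) (Omega `&` ball x (r x)).
  apply/seteqP; split => // x Ox.
  have [y yD xy] := cov x (subset_closure Ox).
  by rewrite -bigcup_seq; exists y.
rewrite {1}OE; apply: le_trans (KP e g c eg) _.
by rewrite -mulrA ler_wpM2l// mulrDl mul1r lerD2l.
Qed.

End poincare_wirtinger.

(** * Sobolev functions and Green's formula *)

Section sobolev_algebra.
Context {R : realType} {d : nat}.
Local Notation mu := (@lebesgue_rV R d).
Variable Omega : set 'rV[R]_d.
Hypotheses (oO : open Omega) (bO : bounded_set Omega).
Let mO : measurable Omega := open_measurable_rV oO.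
Let finO : (mu Omega < +oo)%E := lebesgue_bounded bO mO.
Implicit Types (e f u v w phi l : 'rV[R]_d -> R) (g : 'I_d -> 'rV[R]_d -> R).

Let testL phi : test_function Omega phi -> L2 Omega phi.
Proof. exact: (test_function_L2 oO finO). Qed.

(** Two functions with the same products against test functions agree almost
    everywhere; only their norms matter here. *)
Lemma eq_weak_norm f l : L2 Omega f -> L2 Omega l ->
  (forall phi, test_function Omega phi -> L2ip Omega f phi = L2ip Omega l phi) ->
  L2norm Omega f = L2norm Omega l.
Proof.
move=> fL gL fg; apply/eqP; rewrite -subr_eq0 -normr_le0.
apply: le_trans (L2norm_triangle mO fL gL) _.
apply: (L2norm_le_dual oO finO) => //; first exact: L2B.
by move=> phi tphi; have pL := testL tphi; rewrite L2ipBl// fg// subrr normr0 mul0r.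
Qed.

Lemma weak_pderivP i v : (exists l, L2 Omega l /\ is_weak_pderiv Omega i v l) ->
  L2 Omega (weak_pderiv Omega i v) /\ is_weak_pderiv Omega i v (weak_pderiv Omega i v).
Proof. by move=> h; have := xgetPex (cst 0) h. Qed.

Lemma weak_laplacianP v : (exists l, L2 Omega l /\ is_weak_laplacian Omega v l) ->
  L2 Omega (weak_laplacian Omega v) /\ is_weak_laplacian Omega v (weak_laplacian Omega v).
Proof. by move=> h; have := xgetPex (cst 0) h. Qed.

Lemma H1_weak_gradient v : H1 Omega v -> weak_gradient Omega v (fun i => weak_pderiv Omega i v).
Proof.
move=> [vL vg]; split => // i; [exact: (weak_pderivP (vg i)).1|exact: (weak_pderivP (vg i)).2].
Qed.

Lemma weak_gradient_H1 v g : weak_gradient Omega v g -> H1 Omega v.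
Proof. by move=> [vL gL vg]; split => // i; exists (g i). Qed.

Definition gradip g h : R := \sum_i L2ip Omega (g i) (h i).

Lemma gradip_ge0 g : 0 <= gradip g g.
Proof. by apply: sumr_ge0 => i _; exact: L2ip_ge0. Qed.

(** Weak derivatives being unique almost everywhere, the seminorm can be
    computed from any weak gradient. *)
Lemma H1seminormE v g : weak_gradient Omega v g ->
  H1seminorm Omega v = Num.sqrt (gradip g g).
Proof.
move=> vg; have [vL pL vp] := H1_weak_gradient (weak_gradient_H1 vg).
have [_ gL vg'] := vg.
rewrite /H1seminorm; congr Num.sqrt; apply: eq_bigr => i _.
rewrite -L2norm_sqr//; congr (_ ^+ 2); apply: eq_weak_norm => // phi tphi.
by apply: oppr_inj; rewrite /L2ip -vp// -vg'.
Qed.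

Lemma H1seminorm_ge0 v : 0 <= H1seminorm Omega v.
Proof. exact: sqrtr_ge0. Qed.

Lemma H1seminorm_sqr v g : weak_gradient Omega v g -> H1seminorm Omega v ^+ 2 = gradip g g.
Proof. by move=> vg; rewrite (H1seminormE vg) sqr_sqrtr ?gradip_ge0. Qed.

Lemma L2norm_laplacianE v l : L2 Omega l -> is_weak_laplacian Omega v l ->
  L2norm Omega (weak_laplacian Omega v) = L2norm Omega l.
Proof.
move=> lL vl; have [wL vw] := weak_laplacianP (ex_intro _ l (conj lL vl)).
by apply: eq_weak_norm => // phi tphi; rewrite /L2ip -vw// -vl.
Qed.

Lemma weak_gradientB v w g h : weak_gradient Omega v g -> weak_gradient Omega w h ->
  weak_gradient Omega (fun x => v x - w x) (fun i x => g i x - h i x).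
Proof.
move=> [vL gL vg] [wL hL wh]; split => [|i|i phi tphi]; [exact: L2B|exact: L2B|].
have pL := testL (test_function_pderiv i tphi).
rewrite -[LHS]/(L2ip _ _ _) -[X in - X]/(L2ip _ (fun x => g i x - h i x) phi).
have p'L := testL tphi; rewrite !L2ipBl// /L2ip vg// wh//; ring.
Qed.

Lemma weak_gradient_cst (c : R) : weak_gradient Omega (fun=> c) (fun _ _ => 0).
Proof.
split => [|i|i]; [exact: L2_cst|exact: L2_cst|exact: weak_pderiv_cst].
Qed.

Lemma weak_gradient_test phi : test_function Omega phi ->
  weak_gradient Omega phi (fun i => pderiv i phi).
Proof.
move=> tphi; split => [|i|i]; first exact: testL.
- by apply: testL; exact: test_function_pderiv.
- exact: weak_pderiv_test.
Qed.

Let lapL phi : test_function Omega phi ->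
  L2 Omega (fun x => \sum_(i < d) pderiv i (pderiv i phi) x).
Proof.
move=> tphi; apply: L2_sumr => // [|i]; first exact: L2_cst.
by apply: testL; do 2 apply: test_function_pderiv.
Qed.

Lemma weak_laplacianB v w l l' : L2 Omega v -> L2 Omega w -> L2 Omega l -> L2 Omega l' ->
  is_weak_laplacian Omega v l -> is_weak_laplacian Omega w l' ->
  is_weak_laplacian Omega (fun x => v x - w x) (fun x => l x - l' x).
Proof.
move=> vL wL lL l'L vl wl' phi tphi; have sL := lapL tphi.
rewrite -[LHS]/(L2ip _ _ _) -[RHS]/(L2ip _ (fun x => l x - l' x) phi).
by have pL := testL tphi; rewrite !L2ipBl// /L2ip vl// wl'.
Qed.

Lemma gradipC g h : gradip g h = gradip h g.
Proof. by apply: eq_bigr => i _; exact: L2ipC. Qed.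

Lemma L2norm_le_gradip g i : L2norm Omega (g i) <= Num.sqrt (gradip g g).
Proof.
rewrite -[leLHS]ger0_norm ?L2norm_ge0// -sqrtr_sqr ler_wsqrtr// L2norm_sqr//.
by rewrite /gradip (bigD1 i)//= lerDl; apply: sumr_ge0 => j _; exact: L2ip_ge0.
Qed.

Lemma gradnorm_le g : gradnorm Omega g <= d%:R * Num.sqrt (gradip g g).
Proof.
rewrite -[X in X%:R](card_ord d) mulr_natl -sumr_const.
by apply: ler_sum => i _; exact: L2norm_le_gradip.
Qed.

Lemma gradip_quad g h (t : R) : (forall i, L2 Omega (g i)) -> (forall i, L2 Omega (h i)) ->
  gradip (fun i x => g i x + t * h i x) (fun i x => g i x + t * h i x) =
  gradip g g + t * (gradip g h *+ 2) + t ^+ 2 * gradip h h.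
Proof.
move=> gL hL; rewrite /gradip -sumrMnl !mulr_sumr -!big_split /=.
apply: eq_bigr => i _; rewrite -L2norm_sqr// L2norm_quad// !L2norm_sqr//.
Qed.

Lemma gradip_le g h : (forall i, L2 Omega (g i)) -> (forall i, L2 Omega (h i)) ->
  `|gradip g h| <= Num.sqrt (gradip g g) * Num.sqrt (gradip h h).
Proof.
move=> gL hL; apply: quadratic_ge0_le; [exact: sqrtr_ge0..|] => t.
by rewrite !sqr_sqrtr ?gradip_ge0// -gradip_quad// gradip_ge0.
Qed.

Lemma gradipBl g g' h : (forall i, L2 Omega (g i)) -> (forall i, L2 Omega (g' i)) ->
  (forall i, L2 Omega (h i)) ->
  gradip (fun i x => g i x - g' i x) h = gradip g h - gradip g' h.
Proof.
move=> gL g'L hL; rewrite /gradip -sumrB; apply: eq_bigr => i _; exact: L2ipBl.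
Qed.

Lemma H1seminorm_triangle v w g h : weak_gradient Omega v g -> weak_gradient Omega w h ->
  H1seminorm Omega v <= H1seminorm Omega (fun x => v x - w x) + H1seminorm Omega w.
Proof.
move=> vg wh; have vwgh := weak_gradientB vg wh.
have [_ kL _] := vwgh; have [_ hL _] := wh.
have cs := le_trans (ler_norm _) (gradip_le kL hL).
rewrite -(H1seminormE vwgh) -(H1seminormE wh) in cs.
rewrite -(@ler_pXn2r _ 2) ?nnegrE ?addr_ge0 ?H1seminorm_ge0//.
have := gradip_quad 1 kL hL.
rewrite -(H1seminorm_sqr vwgh) -(H1seminorm_sqr wh).
have -> : gradip (fun i x => g i x - h i x + 1 * h i x) (fun i x => g i x - h i x + 1 * h i x) = gradip g g.
  by apply: eq_bigr => i _; apply: eq_L2ip => x _; rewrite mul1r subrK.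
rewrite -(H1seminorm_sqr vg) => ->; lra.
Qed.

Lemma green_test phi e g l : test_function Omega phi -> weak_gradient Omega e g ->
  L2 Omega l -> is_weak_laplacian Omega e l ->
  gradip (fun i => pderiv i phi) g = - L2ip Omega phi l.
Proof.
move=> tphi [eL gL eg] lL el.
have dL i : L2 Omega (pderiv i (pderiv i phi)).
  by apply: testL; do 2 apply: test_function_pderiv.
have := el phi tphi; rewrite -[LHS]/(L2ip _ e (fun x => \sum_i pderiv i (pderiv i phi) x)).
rewrite L2ip_sumr// -[RHS]/(L2ip _ l phi) [RHS]L2ipC => <-.
rewrite -sumrN; apply: eq_bigr => i _.
by rewrite [in RHS]/L2ip eg ?opprK; [rewrite L2ipC|exact: test_function_pderiv].
Qed.

(** Green's formula against a function vanishing on the boundary, by density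
    of the test functions. *)
Lemma green_H10 u gu e g l : H10 Omega u -> weak_gradient Omega u gu ->
  weak_gradient Omega e g -> L2 Omega l -> is_weak_laplacian Omega e l ->
  gradip gu g = - L2ip Omega u l.
Proof.
move=> [_ u0] ugu eg lL el; apply/eqP; rewrite -subr_eq0 opprK -normr_le0.
have [uL guL _] := ugu; have [eL gL _] := eg.
set M := gradnorm Omega g + L2norm Omega l.
have M0 : 0 <= M by rewrite addr_ge0 ?gradnorm_ge0 ?L2norm_ge0.
apply/ler_addgt0Pr => s s0; rewrite add0r.
have M1 : 0 < M + 1 by rewrite ltr_wpDl.
have [phi tphi] := u0 (s / (M + 1)) (divr_gt0 s0 M1).
set t := s / (M + 1); have tg := weak_gradient_test tphi; have [pL dL _] := tg.
have upg := weak_gradientB ugu tg; have [kL hL _] := upg.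
rewrite -[u \- phi]/(fun x => u x - phi x) /H1norm (H1seminorm_sqr upg) => hlt.
have sq0 : 0 <= L2norm Omega (fun x => u x - phi x) ^+ 2 by exact: sqr_ge0.
have h1 : L2norm Omega (fun x => u x - phi x) <= t.
  apply: le_trans (ltW hlt); rewrite -[leLHS]ger0_norm ?L2norm_ge0// -sqrtr_sqr.
  by rewrite ler_wsqrtr// lerDl gradip_ge0.
have h2 i : L2norm Omega (fun x => gu i x - pderiv i phi x) <= t.
  apply: le_trans (L2norm_le_gradip (fun i x => gu i x - pderiv i phi x) i) _.
  by apply: le_trans (ltW hlt); rewrite ler_wsqrtr// lerDr.
have -> : gradip gu g + L2ip Omega u l =
    gradip (fun i x => gu i x - pderiv i phi x) g + L2ip Omega (fun x => u x - phi x) l.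
  by rewrite gradipBl// L2ipBl// (green_test tphi eg lL el) opprK; ring.
apply: le_trans (ler_normD _ _) _.
have -> : s = t * gradnorm Omega g + t * L2norm Omega l + t.
  by rewrite -mulrDr -/M -[X in _ + X]mulr1 -mulrDr divfK// gt_eqF.
have t0 : 0 <= t by rewrite ltW// divr_gt0.
rewrite -[leLHS]addr0 lerD// lerD//.
  apply: le_trans (ler_norm_sum _ _ _) _; rewrite /gradnorm mulr_sumr; apply: ler_sum => i _.
  by apply: le_trans (L2ip_le mO (hL i) (gL i)) _; rewrite ler_wpM2r ?L2norm_ge0.
by apply: le_trans (L2ip_le mO kL lL) _; rewrite ler_wpM2r ?L2norm_ge0.
Qed.

End sobolev_algebra.

(** * The error estimate *)

Section error_estimate.
Context {R : realType} {d : nat}.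
Local Notation mu := (@lebesgue_rV R d).
Variable Omega : set 'rV[R]_d.
Hypotheses (oO : open Omega) (bO : bounded_set Omega).
Let mO : measurable Omega := open_measurable_rV oO.
Implicit Types (e f u v w l : 'rV[R]_d -> R) (g : 'I_d -> 'rV[R]_d -> R).

(** When the gradient of [u] vanishes the left-hand side is zero; otherwise
    the quotient of the two norms of [u] is at most the Poincare constant. *)
Lemma gradip_le_laplacian u gu (C : R) : 0 < C -> (poincare Omega < C%:E)%E ->
  H10 Omega u -> weak_gradient Omega u gu ->
  exists2 D : R, 0 <= D < C & forall e g l, weak_gradient Omega e g -> L2 Omega l ->
    is_weak_laplacian Omega e l ->
    `|gradip Omega gu g| <= D * H1seminorm Omega u * L2norm Omega l.
Proof.
move=> C0 CP u0 ugu; have [uL guL _] := ugu.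
have sE := H1seminormE oO bO ugu.
have [su0|su0] := eqVneq (H1seminorm Omega u) 0.
  exists 0; first by rewrite lexx.
  move=> e g l [_ gL _] _ _; rewrite !mul0r.
  by apply: le_trans (gradip_le oO guL gL) _; rewrite -sE su0 mul0r.
have s0 : 0 < H1seminorm Omega u by rewrite lt_neqAle eq_sym su0 H1seminorm_ge0.
exists (L2norm Omega u / H1seminorm Omega u); last first.
  move=> e g l eg lL el; rewrite divfK// (green_H10 oO bO u0 ugu eg lL el) normrN.
  exact: L2ip_le.
rewrite divr_ge0 ?L2norm_ge0 ?H1seminorm_ge0//=.
have [uae|nae] := pselect (ae_eq mu Omega u (cst 0)).
  have L0 : L2 Omega (cst 0 : 'rV[R]_d -> R) by apply: L2_cst => //; exact: lebesgue_bounded.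
  by rewrite (L2norm_ae mO uL L0 uae) L2norm0 mul0r.
by rewrite -lte_fin; apply: le_lt_trans CP; apply: ereal_sup_ubound; exists u.
Qed.

(** Here [a], [b], [n] are the seminorms of [u], [v - u] and [v], [X] is the
    product of the gradients of [u] and [v - u], and [r] is the norm of the
    Laplacian of [v - u]. The two hypotheses on [X] give [a - D r <= n], which
    with the last hypothesis bounds [r] by [E / (C - D)]; then the expansion of
    [n ^+ 2] bounds [b ^+ 2]. *)
Lemma energy_estimate (C D a b n X r E : R) : 0 <= D < C -> 0 <= a -> 0 <= b ->
  0 <= n -> 0 <= r -> 0 <= E -> n ^+ 2 = a ^+ 2 + X *+ 2 + b ^+ 2 ->
  a ^+ 2 + X <= a * n -> `|X| <= D * a * r -> C * r + n <= a + E ->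
  b <= (1 + Num.sqrt (a *+ 2 + D * a / (C - D) *+ 2)) * (E + Num.sqrt E).
Proof.
move=> /andP[D0 DC] a0 b0 n0 r0 E0 nE Xn; rewrite ler_norml => /andP[X1 X2] CE.
have CD : 0 < C - D by rewrite subr_gt0.
have na : a - D * r <= n.
  have [a_eq0|a_neq0] := eqVneq a 0.
    by have := mulr_ge0 D0 r0; lra.
  have ap : 0 < a by rewrite lt_neqAle eq_sym a_neq0.
  by rewrite -(ler_pM2l ap); lra.
have rE : r <= E / (C - D) by rewrite ler_pdivlMr//; lra.
set k := a *+ 2 + D * a / (C - D) *+ 2.
have k0 : 0 <= k by rewrite addr_ge0 ?mulrn_wge0// divr_ge0 ?mulr_ge0// ltW.
have bE : b ^+ 2 <= k * E + E ^+ 2.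
  have Cr : 0 <= C * r by apply: mulr_ge0 => //; lra.
  have h1 : n <= a + E by lra.
  have h2 : n ^+ 2 <= (a + E) ^+ 2 by rewrite lerXn2r ?nnegrE// addr_ge0.
  have h3 : D * a * r <= D * a * (E / (C - D)) by rewrite ler_wpM2l// mulr_ge0.
  have h4 : k * E = a * E *+ 2 + D * a * (E / (C - D)) *+ 2 by rewrite /k; ring.
  rewrite h4; lra.
have sE0 := sqrtr_ge0 E; have sk0 := sqrtr_ge0 k.
have bb : b <= Num.sqrt k * Num.sqrt E + E.
  rewrite -(@ler_pXn2r _ 2) ?nnegrE ?addr_ge0 ?mulr_ge0//.
  apply: le_trans bE _; rewrite sqrrD exprMn !sqr_sqrtr//.
  by rewrite lerD2r lerDl mulrn_wge0// !mulr_ge0.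
apply: le_trans bb _; have := mulr_ge0 sk0 E0; lra.
Qed.

End error_estimate.

Theorem theorem3p2 (R : realType) (d : nat) (d_gt0 : (0 < d)%N)
    (Omega : set 'rV[R]_d) (Omega_dom : bounded_lipschitz_domain Omega)
    (f u : 'rV[R]_d -> R) (f_L2 : L2 Omega f)
    (u_sol : dirichlet_solution Omega f u)
    (C : R) (C_gt0 : 0 < C) (C_gt_CP : (poincare Omega < C%:E)%E) :
  exists2 K : R, 0 < K &
    forall (sigma : nat -> R -> R) (hidden : seq nat)
      (Theta : set (fcnn_param d hidden)),
    let N := fcnn_class sigma Theta in
    Theta !=set0 -> N `<=` H1_laplacian Omega ->
    forall (eps : R) (v : 'rV[R]_d -> R), 0 < eps ->
    suboptimal_minimizer Omega f C N eps v ->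
    let E w := C * L2norm Omega (weak_laplacian Omega (w \- u)) +
               H1seminorm Omega (w \- u) + eps in
    inf [set H1norm Omega (fun x => v x - u x - c) | c in [set: R]] <=
    K * inf [set E w + Num.sqrt (E w) | w in N].

Proof.
have [_ oO _ bO _] := Omega_dom.
have mO := open_measurable_rV oO.
have finO := lebesgue_bounded bO mO.
have [[uH1 _] u0 ulap] := u_sol.
have ugu := H1_weak_gradient uH1; set gu := (fun i => weak_pderiv Omega i u) in ugu.
have [uL guL _] := ugu.
have NfL : L2 Omega (\- f) by exact: L2N.
have [D DC XP] := gradip_le_laplacian oO bO C_gt0 C_gt_CP u0 ugu.
have [K0 K00 PW] := poincare_wirtinger Omega_dom.
set a := H1seminorm Omega u in XP.
pose k := 1 + Num.sqrt (a *+ 2 + D * a / (C - D) *+ 2).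
have k0 : 0 < k by rewrite ltr_pwDl// sqrtr_ge0.
have K0d : 0 <= K0 * d%:R by rewrite mulr_ge0.
have K0d1 : 0 < K0 * d%:R + 1 by rewrite ltr_wpDl.
(* [d] compares [gradnorm] with the seminorm, and the summand [1] accounts for
   the seminorm inside the H^1 norm *)
exists ((K0 * d%:R + 1) * k); first by rewrite mulr_gt0.
move=> sigma hidden Theta N [theta Ttheta] NV eps v eps0 [Nv vmin].
pose E w := C * L2norm Omega (weak_laplacian Omega (w \- u)) +
            H1seminorm Omega (w \- u) + eps.
rewrite -[X in is_true X]/(inf [set H1norm Omega (fun x => v x - u x - c) | c in [set: R]] <=
  (K0 * d%:R + 1) * k * inf [set E w + Num.sqrt (E w) | w in N]).
(* [- f] is the Laplacian of [u], so [weak_laplacian w + f] is that of [w - u] *)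
have errP w : H1_laplacian Omega w ->
    [/\ weak_gradient Omega (fun x => w x - u x)
          (fun i x => weak_pderiv Omega i w x - gu i x),
        L2 Omega (weak_laplacian Omega w \+ f) &
        is_weak_laplacian Omega (fun x => w x - u x) (weak_laplacian Omega w \+ f)].
  move=> [wH1 wlap]; have [lL wl] := weak_laplacianP wlap.
  have wgw := H1_weak_gradient wH1; have [wL _ _] := wgw.
  split; [exact: weak_gradientB|exact: L2D|].
  have := weak_laplacianB oO bO wL uL lL NfL wl ulap.
  by congr is_weak_laplacian; apply/funext => x /=; rewrite opprK.
have E0 w : 0 <= C * L2norm Omega (weak_laplacian Omega (w \- u)) + H1seminorm Omega (w \- u).
  by rewrite addr_ge0 ?H1seminorm_ge0// mulr_ge0 ?L2norm_ge0// ltW.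
have res0 w : 0 <= residual Omega f C w.
  by rewrite addr_ge0 ?H1seminorm_ge0// mulr_ge0 ?L2norm_ge0// ltW.
have resE w : N w -> residual Omega f C w + eps <= a + E w.
  move=> Nw; have [wg lL wl] := errP w (NV w Nw).
  have [wH1 _] := NV w Nw.
  rewrite /E (L2norm_laplacianE oO bO lL wl) /residual.
  have := H1seminorm_triangle oO bO (H1_weak_gradient wH1) ugu; rewrite -/a.
  rewrite -[w \- u]/(fun x => w x - u x); lra.
have resv w : N w -> residual Omega f C v <= a + E w.
  move=> Nw; apply: le_trans (resE w Nw); apply: le_trans vmin _.
  rewrite lerD2r; apply: inf_lbound; last by exists w.
  by exists 0 => _ [w' _ <-].
have [vg lL vl] := errP v (NV v Nv); have [vH1 _] := NV v Nv.
have vgv := H1_weak_gradient vH1; have [vL gvL _] := vgv.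
set gv := (fun i => weak_pderiv Omega i v) in vgv gvL.
set l := weak_laplacian Omega v \+ f in lL vl.
pose ge i x := weak_pderiv Omega i v x - gu i x.
have {}vg : weak_gradient Omega (fun x => v x - u x) ge by [].
have [eL geL _] := vg.
have [c hc] := PW _ _ vg.
set b := H1seminorm Omega (fun x => v x - u x).
have bE := H1seminormE oO bO vg; rewrite -/b in bE.
have b0 : 0 <= b by exact: H1seminorm_ge0.
have gradb : gradnorm Omega ge <= d%:R * b by rewrite bE; exact: gradnorm_le.
have nE : H1seminorm Omega v ^+ 2 = a ^+ 2 + gradip Omega gu ge *+ 2 + b ^+ 2.
  have := gradip_quad oO 1 guL geL.
  rewrite -(H1seminorm_sqr oO bO ugu) -(H1seminorm_sqr oO bO vg) mul1r expr1n mul1r => <-.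
  rewrite (H1seminorm_sqr oO bO vgv); apply: eq_bigr => i _.
  by apply: eq_L2ip => x _; rewrite mul1r /ge addrC subrK.
have Xn : a ^+ 2 + gradip Omega gu ge <= a * H1seminorm Omega v.
  have := gradip_le oO guL gvL.
  rewrite -(H1seminormE oO bO ugu) -(H1seminormE oO bO vgv); apply: le_trans.
  have := gradipBl oO gvL guL guL.
  rewrite -(H1seminorm_sqr oO bO ugu) (gradipC _ gu) => ->.
  by rewrite addrC subrK (gradipC _ gv) ler_norm.
have H1c : H1norm Omega (fun x => v x - u x - c) <= (K0 * d%:R + 1) * b.
  have vcg := weak_gradientB oO bO vg (weak_gradient_cst oO bO c).
  have sE : H1seminorm Omega (fun x => v x - u x - c) = b.
    rewrite bE (H1seminormE oO bO vcg); congr Num.sqrt; apply: eq_bigr => i _.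
    by apply: eq_L2ip => x _; rewrite subr0.
  have n0 := L2norm_ge0 Omega (fun x => v x - u x - c).
  apply: (@le_trans _ _ (L2norm Omega (fun x => v x - u x - c) + b)).
    rewrite /H1norm sE -[leRHS]ger0_norm ?addr_ge0// -sqrtr_sqr ler_wsqrtr//.
    by rewrite sqrrD addrAC lerDl mulrn_wge0// mulr_ge0.
  rewrite mulrDl mul1r lerD2r; apply: le_trans hc _.
  by rewrite -mulrA ler_wpM2l.
have main w : N w -> inf [set H1norm Omega (fun x => v x - u x - c) | c in [set: R]] <=
    (K0 * d%:R + 1) * k * (E w + Num.sqrt (E w)).
  move=> Nw; apply: (@le_trans _ _ (H1norm Omega (fun x => v x - u x - c))).
    apply: inf_lbound; last by exists c.
    by exists 0 => _ [c' _ <-]; exact: sqrtr_ge0.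
  apply: le_trans H1c _; rewrite -mulrA; apply: ler_wpM2l; first exact: ltW.
  have Ew0 : 0 <= E w by rewrite addr_ge0 ?E0// ltW.
  apply: (energy_estimate DC _ b0 _ _ Ew0 nE Xn (XP _ _ _ vg lL vl)).
  - exact: H1seminorm_ge0.
  - exact: H1seminorm_ge0.
  - exact: L2norm_ge0.
  - exact: resv.
rewrite mulrC -ler_pdivrMr ?mulr_gt0//.
apply: lb_le_inf; first by exists (E v + Num.sqrt (E v)), v.
by move=> _ [w Nw <-]; rewrite ler_pdivrMr ?mulr_gt0// mulrC main.
Qed.
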